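(* Let the random measure $\xi$ on $\mathbb R^d$ have a density field $Z=(Z_s)_{s\in\mathbb R^d}$. If $(X,Z)$ is stationary under a measure $\mathbf P$, then $((X,Z),\xi)$ is mass-stationary under the measure $\mathbf P^\circ$ defined by $$d\mathbf P^\circ=Z_0\,d\mathbf P,$$ and $((X,Z),\xi)$ under $\mathbf P^\circ$ is the Palm version of $((X,Z),\xi)$ under $\mathbf P$.
   Context: Setting. $(\Omega,\mathcal F)$ is a measurable space carrying the random elements (extended if further randomization is needed); $\mathbf P$ and $\mathbf P^\circ$ are measures on it, not necessarily probability measures, with integrals $\mathbf E$, $\mathbf E^\circ$. $\lambda$ is Lebesgue measure on $\mathbb R^d$. For a measure $\mu$ and a set $A$ with $0<\mu(A)<\infty$, $\mu(\cdot\mid A):=\mu(\cdot\cap A)/\mu(A)$. The symbol $\overset{D}{=}$ denotes equality of distributions (under the indicated measure). A random element $W$ in a measurable space $(G,\mathcal G)$ on which the additive group $\mathbb R^d$ acts by maps $\theta_t$ is called shift-measurable if $(t,w)\mapsto\theta_tw$ is measurable from $\mathbb R^d\times G$ to $G$. $X$ is a shift-measurable random element in a space $(E,\mathcal E)$. For a random field $Z=(Z_s)_{s\in\mathbb R^d}$, regarded as a random element of a shift-invariant path space with the $\sigma$-algebra generated by the evaluations, $\theta_tZ:=(Z_{t+s})_{s\in\mathbb R^d}$. For a measure, $\theta_t\xi(B):=\xi(B+t)$ for Borel $B\subseteq\mathbb R^d$. Shifts act componentwise: $\theta_t(X,Z)=(\theta_tX,\theta_tZ)$ and $\theta_t((X,Z),\xi)=(\theta_t(X,Z),\theta_t\xi)$.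 Random measures are locally finite. The distributions of $((X,Z),\xi)$ under $\mathbf P$ and $\mathbf P^\circ$ are understood to be $\sigma$-finite. Density field: $\xi$ has density field $Z$ if $Z=(Z_s)_{s\in\mathbb R^d}$ is a shift-measurable random field with values in $[0,\infty)$ and $\xi(ds)=Z_s\,ds$. Stationarity: $(X,Z)$ is stationary under $\mathbf P$ if $\theta_t(X,Z)\overset{D}{=}(X,Z)$ under $\mathbf P$ for all $t\in\mathbb R^d$ (and similarly for $((X,Z),\xi)$). Mass-stationarity: for a shift-measurable random element $W$ and a random measure $\xi$ having $0$ in its support $\mathbf P^\circ$-a.e., $(W,\xi)$ is mass-stationary under $\mathbf P^\circ$ if for all bounded Borel $C\subset\mathbb R^d$ with $\lambda(C)>0$ and $\lambda(\partial C)=0$, $$(\theta_{V_C}(W,\xi),V_C+U_C)\overset{D}{=}((W,\xi),U_C)\quad\text{under }\mathbf P^\circ,$$ where under $\mathbf P^\circ$ the conditional distribution of $U_C$ given $(W,\xi)$ is uniform on $C$ and the conditional distribution of $V_C$ given $((W,\xi),U_C)$ is $\xi(\cdot\mid C-U_C)$, with $C-x:=\{y-x:y\in C\}$. Here $W=(X,Z)$. Palm version: $(W,\xi)$ under $\mathbf P^\circ$ is the Palm version of a stationary pair $(W,\xi)$ under $\mathbf P$ if for each nonnegative measurable $f$ and some (equivalently each) Borel $B\subset\mathbb R^d$ with $0<\lambda(B)<\infty$, $$\mathbf E^\circ[f(W,\xi)]=\mathbf E\Big[\int_B f(\theta_t(W,\xi))\,\xi(dt)\Big]\Big/\lambda(B).$$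 *)

(* Defs.v *)
(* R^d is 'rV[R]_d, with its library topology (sup norm) and the Borel
   sigma-algebra generated by the open sets. *)
From HB Require Import structures.
From mathcomp Require Import all_boot all_order all_algebra.
From mathcomp Require Import all_classical all_reals all_analysis.
From mathcomp Require Import measurable_realfun.

Set Implicit Arguments.
Unset Strict Implicit.
Unset Printing Implicit Defensive.

Import Order.TTheory GRing.Theory Num.Def Num.Theory.
Import numFieldNormedType.Exports.

Local Open Scope classical_set_scope.
Local Open Scope ring_scope.

Definition borel_display : measure_display. Proof. by []. Qed.

HB.instance Definition _ (R : realType) (d : nat) :=
  @isMeasurable.Build borel_display 'rV[R]_d <<s (@open 'rV[R]_d) >>
    (@sigma_algebra0 _ setT _) (@sigma_algebraC _ _) (@sigma_algebra_bigcup _ setT _).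

Section borel_Rd.
Context {R : realType}.

Lemma open_measurable_rV d (U : set 'rV[R]_d) : open U -> measurable U.
Proof. exact: sub_gen_smallest. Qed.

Lemma measurable_fun_rV d d' (T : measurableType d') (f : T -> 'rV[R]_d) :
  (forall U, open U -> measurable (f @^-1` U)) -> measurable_fun setT f.
Proof.
move=> h; apply: (@measurability _ _ T 'rV[R]_d setT f (@open 'rV[R]_d)) => //.
by move=> _ [U oU <-]; rewrite setTI; exact: h.
Qed.

Lemma continuous_measurable_rV d (f : 'rV[R]_d -> R) :
  continuous f -> measurable_fun setT f.
Proof.
move=> cf; apply: (measurability _ (RGenOpens.measurableE R)).
move=> _ [_ [a [b ->]] <-]; rewrite setTI; apply: open_measurable_rV.
by move/continuousP : cf; apply; exact: interval_open.
Qed.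

Lemma continuous_measurable_rVrV d e (f : 'rV[R]_d -> 'rV[R]_e) :
  continuous f -> measurable_fun setT f.
Proof.
move=> /continuousP cf; apply: measurable_fun_rV => U oU.
by apply: open_measurable_rV; exact: cf.
Qed.

Definition cons_rV d (p : measurableTypeR R * 'rV[R]_d) : 'rV[R]_d.+1 :=
  row_mx (p.1%:M : 'M[R]_1) p.2.

Definition uncons_rV d (v : 'rV[R]_d.+1) : measurableTypeR R * 'rV[R]_d :=
  (v ord0 ord0, @rsubmx _ 1 1 d v).

Lemma cons_rVK d : cancel (@cons_rV d) (@uncons_rV d).
Proof.
move=> [x v]; rewrite /uncons_rV /cons_rV row_mxKr; congr pair.
have -> : ord0 = lshift d (ord0 : 'I_1) by exact/val_inj.
by rewrite (@row_mxEl _ 1 1 d) mxE eqxx.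
Qed.

Lemma measurable_uncons_rV d : measurable_fun setT (@uncons_rV d).
Proof.
apply: measurable_fun_pair => /=.
  apply: continuous_measurable_rV => v.
  exact (@coord_continuous R 1 d.+1 ord0 ord0 v).
apply: continuous_measurable_rVrV => v.
apply/(@cvg_ballP _ _ _ _ (nbhs_filter v)) => e e0.
apply/nbhs_ballP; exists e => //= w [_ vw]; split=> // i j.
by rewrite !mxE; exact: vw.
Qed.

Let near_rat (y s : R) : 0 < s -> exists q : rat, ball (ratr q : R) s y.
Proof.
move=> s0; have /rat_in_itvoo[q] : y - s < y + s.
  by rewrite ltrBlDr -addrA ltrDl; exact: addr_gt0.
rewrite in_itv/= => /andP[q1 q2]; exists q.
rewrite /ball/= ltr_norml; apply/andP; split.
  by rewrite ltrBrDl; exact: q1.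
by rewrite ltrBlDl; exact: q2.
Qed.

Let ex_rat (e : R) : 0 < e -> exists2 r : rat, 0 < (ratr r : R) & ratr r < e.
Proof.
move=> /rat_in_itvoo[r]; rewrite in_itv/= => /andP[r1 r2]; exists r.
  exact: r1.
exact: r2.
Qed.

Lemma measurable_cons_rV d : measurable_fun setT (@cons_rV d).
Proof.
apply: measurable_fun_rV => U oU.
pose box (i : rat * 'rV[rat]_d * rat) : set (measurableTypeR R * 'rV[R]_d) :=
  ball (ratr i.1.1 : R) (ratr i.2 : R) `*`
  ball (map_mx ratr i.1.2 : 'rV[R]_d) (ratr i.2 : R).
pose F n := if unpickle n is Some i then
  if `[< box i `<=` @cons_rV d @^-1` U >] then box i else set0 else set0.
suff -> : @cons_rV d @^-1` U = \bigcup_n F n.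
  apply: bigcupT_measurable => n; rewrite /F; case: unpickle => [i|//].
  case: ifP => // _; apply: measurableX; [exact: measurable_ball|].
  apply: open_measurable_rV; exact: (@ball_open R ('rV[R]_d : normedModType R)).
apply/seteqP; split=> [[x v] Uxv|p [n _]]; last first.
  by rewrite /F; case: unpickle => [i|//]; case: asboolP => // h; exact: h.
have /nbhs_ballP[e /= e0 eU] : nbhs (cons_rV (x, v)) U by exact: open_nbhs_nbhs.
have e20 : 0 < e / 2 by rewrite divr_gt0.
have [r r0 re] := ex_rat e20.
have [q qx] := near_rat x r0.
have /choice[w wv] := fun j => near_rat (v ord0 j) r0.
pose i := (q, \row_j w j, r); exists (pickle i); [exact: I|].
have near_tri (c a b : R) : ball c (ratr r : R) a -> ball c (ratr r : R) b ->
    ball a e b.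
  move=> ca cb; apply: (@le_ball _ _ _ (e / 2 + e / 2)).
    by rewrite -splitr.
  apply: (ball_triangle (y := c)).
    by apply: ball_sym; apply: le_ball ca; exact: ltW.
  by apply: le_ball cb; exact: ltW.
rewrite /F pickleK; case: asboolP => [_|]; last first.
  case=> -[y u] [/= qy [_ wu]]; apply: eU; split=> // k j.
  rewrite (ord1 k) /cons_rV; case: (@split_ordP 1 d j) => j' ->.
    rewrite !(@row_mxEl _ 1 1 d) !mxE !ord1 /= !mulr1n.
    exact: near_tri qx qy.
  rewrite !(@row_mxEr _ 1 1 d) /=; apply: near_tri (wv _) _.
  by have := wu ord0 j'; rewrite !mxE.
split; first exact: qx.
split; first exact: r0.
move=> k j; rewrite !mxE ord1; exact: wv.
Qed.

Section lebesgue_step.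
Local Open Scope ereal_scope.
Context (d : nat) (m : {sigma_finite_measure set 'rV[R]_d -> \bar R}).

Definition lebesgue_step : set 'rV[R]_d.+1 -> \bar R :=
  pushforward (lebesgue_measure \x m) (@cons_rV d).

Let mcons A : measurable A -> measurable (@cons_rV d @^-1` A).
Proof. by move=> mA; rewrite -[X in measurable X]setTI; exact: measurable_cons_rV. Qed.

Let step0 : lebesgue_step set0 = 0.
Proof. by rewrite /lebesgue_step /pushforward preimage_set0 measure0. Qed.

Let step_ge0 A : 0 <= lebesgue_step A.
Proof. exact: (@measure_ge0 _ _ _ (lebesgue_measure \x m)). Qed.

Let step_sigma_additive : semi_sigma_additive lebesgue_step.
Proof.
move=> F mF tF mUF; rewrite /lebesgue_step /pushforward preimage_bigcup.
apply: measure_semi_sigma_additive.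
- by move=> n; exact: mcons.
- apply/trivIsetP => /= i j _ _ ij; rewrite -preimage_setI.
  by move/trivIsetP : tF => /(_ _ _ _ _ ij) ->//; rewrite preimage_set0.
- by rewrite -preimage_bigcup; exact: mcons.
Qed.

HB.instance Definition _ := isMeasure.Build _ _ _ lebesgue_step
  step0 step_ge0 step_sigma_additive.

Let step_sigma_finite : sigma_finite setT lebesgue_step.
Proof.
have /sigma_finiteP[F [TF ndF Foo]] := sigma_finiteT (@lebesgue_measure R).
have /sigma_finiteP[G [TG ndG Goo]] := sigma_finiteT m.
exists (fun n => @uncons_rV d @^-1` (F n `*` G n)) => [|n].
  rewrite -preimage_bigcup -[LHS](@preimage_setT _ _ (@uncons_rV d)).
  congr (_ @^-1` _); rewrite -setXTT TF TG.
  apply/seteqP; split=> [[x y] [/= [n _ Fnx] [k _ Gky]]|[x y] [n _ [/= ? ?]]].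
    exists (maxn n k) => //; split.
    - by move: x Fnx; exact/subsetPset/ndF/leq_maxl.
    - by move: y Gky; exact/subsetPset/ndG/leq_maxr.
  by split; exists n.
have [mF Fn] := Foo n; have [mG Gn] := Goo n.
split.
  rewrite -[X in measurable X]setTI; apply: measurable_uncons_rV => //.
  exact: measurableX.
rewrite /lebesgue_step /pushforward -comp_preimage.
rewrite (_ : @uncons_rV d \o @cons_rV d = id); last first.
  by apply/funext; exact: cons_rVK.
by rewrite preimage_id product_measure1E// lte_mul_pinfty// ge0_fin_numE.
Qed.

HB.instance Definition _ := @Measure_isSigmaFinite.Build _ _ _ lebesgue_step
  step_sigma_finite.

End lebesgue_step.

End borel_Rd.

(* Lebesgue measure on R^(d+1) = R * R^d is the product of the library's
   lebesgue_measure on R with Lebesgue measure on R^d; R^0 carries the unit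
   mass. *)
Fixpoint lebesgue_rV (R : realType) (d : nat) :
    {sigma_finite_measure set 'rV[R]_d -> \bar R} :=
  match d with
  | 0%N => \d_(0 : 'rV[R]_0)
  | e.+1 => lebesgue_step (lebesgue_rV R e)
  end.

Section shifts.
Context {R : realType} {d : nat}.
Local Notation Rd := 'rV[R]_d.

Definition shift_measurable dG (G : measurableType dG) (th : Rd -> G -> G) :=
  [/\ forall g, th 0 g = g,
      forall s t g, th (s + t) g = th s (th t g) &
      measurable_fun [set: Rd * G] (fun p => th p.1 p.2)].

Definition pair_shift (G1 G2 : Type) (th1 : Rd -> G1 -> G1)
    (th2 : Rd -> G2 -> G2) (t : Rd) (p : G1 * G2) : G1 * G2 :=
  (th1 t p.1, th2 t p.2).

End shifts.

(* Joint measurability of the shift may fail on a path space (for d > 0 it does on the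
   space of all functions), and is required in density_field. *)
Record path_space (R : realType) (d : nat) := PathSpace {
  path_set :> set ('rV[R]_d -> R);
  path_set_nonempty : path_set !=set0;
  path_set_ge0 : forall z, path_set z -> forall s, 0 <= z s;
  path_set_shift : forall z t, path_set z -> path_set (fun s => z (t + s)) }.

Record path_of (R : realType) (d : nat) (H : path_space R d) := PathOf {
  path_fun :> 'rV[R]_d -> R;
  path_funP : path_set H path_fun }.

Section path_of.
Context {R : realType} {d : nat} {H : path_space R d}.

HB.instance Definition _ := gen_eqMixin (path_of H).
HB.instance Definition _ := gen_choiceMixin (path_of H).
HB.instance Definition _ := isPointed.Build (path_of H)
  (PathOf (projT2 (cid (path_set_nonempty H)))).

Definition path_measurable : set (set (path_of H)) :=
  <<s \bigcup_s preimage_set_system setT (fun z : path_of H => z s) measurable >>.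

Definition path_display : measure_display. Proof. by []. Qed.

HB.instance Definition _ := @isMeasurable.Build path_display (path_of H)
  path_measurable (@sigma_algebra0 _ setT _) (@sigma_algebraC _ _)
  (@sigma_algebra_bigcup _ setT _).

Lemma measurable_path_eval s :
  measurable_fun setT (fun z : path_of H => z s).
Proof.
move=> _ B mB; apply: sub_gen_smallest; exists s => //.
by exists B.
Qed.

Definition path_shift (t : 'rV[R]_d) (z : path_of H) : path_of H :=
  PathOf (@path_set_shift R d H z t (path_funP z)).

End path_of.

Section random_measures.
Context {R : realType} {d : nat}.
Local Notation Rd := 'rV[R]_d.
Local Open Scope ereal_scope.

Record lf_measure := LfMeasure {
  lf_meas :> {measure set Rd -> \bar R};
  lf_measP : forall B : set Rd, measurable B -> bounded_set B -> lf_meas B < +oo }.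

HB.instance Definition _ := gen_eqMixin lf_measure.
HB.instance Definition _ := gen_choiceMixin lf_measure.

Let mzero_lf (B : set Rd) : measurable B -> bounded_set B ->
  (@mzero _ Rd R : {measure set Rd -> \bar R}) B < +oo.
Proof. by move=> _ _; exact: ltry. Qed.

HB.instance Definition _ := isPointed.Build lf_measure (LfMeasure mzero_lf).

Definition lf_measurable : set (set lf_measure) :=
  <<s \bigcup_(B in measurable)
        preimage_set_system setT (fun mu : lf_measure => mu B) measurable >>.

Definition lf_display : measure_display. Proof. by []. Qed.

HB.instance Definition _ := @isMeasurable.Build lf_display lf_measure
  lf_measurable (@sigma_algebra0 _ setT _) (@sigma_algebraC _ _)
  (@sigma_algebra_bigcup _ setT _).

Let preimage_sub (t : Rd) (B : set Rd) :
  (fun x : Rd => x - t)%R @^-1` B = [set x + t | x in B]%R.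
Proof.
apply/seteqP; split=> [x Bx|_ [x Bx <-]] /=; last by rewrite addrK.
by exists (x - t)%R => //; rewrite subrK.
Qed.

Lemma measurable_sub_rV (t : Rd) : measurable_fun setT (fun x : Rd => x - t)%R.
Proof.
apply: continuous_measurable_rVrV => x.
apply/(@cvg_ballP _ _ _ _ (nbhs_filter x)) => e e0.
apply/nbhs_ballP; exists e => //= y [_ xy]; split=> // i j.
have := xy i j; rewrite !mxE /ball/= => h.
by rewrite opprD addrACA subrr addr0.
Qed.

Let shift_lf_meas (t : Rd) (mu : lf_measure) : {measure set Rd -> \bar R} :=
  measure_function_pushforward__canonical__measure_function_Measure
    mu (measurable_sub_rV t).

Let shift_lf_measP (t : Rd) (mu : lf_measure) (B : set Rd) :
  measurable B -> bounded_set B -> shift_lf_meas t mu B < +oo.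
Proof.
move=> mB bB; rewrite /shift_lf_meas/= /pushforward; apply: lf_measP.
  by rewrite -[X in measurable X]setTI; exact: measurable_sub_rV.
have [M [_ BM]] := bB; exists (M + `|t|)%R; split; first exact: num_real.
move=> N MN x /= Bx; have /= := BM (N - `|t|)%R _ _ Bx.
rewrite ltrBrDr lerBrDr => /(_ MN); apply: le_trans.
by rewrite -{1}(subrK t x) ler_normD.
Qed.

(* (theta_t mu)(B) = mu(B + t) *)
Definition lf_shift (t : Rd) (mu : lf_measure) : lf_measure :=
  LfMeasure (shift_lf_measP t mu).

Lemma lf_shiftE t mu B : lf_shift t mu B = mu [set x + t | x in B]%R.
Proof. by rewrite -preimage_sub. Qed.

End random_measures.
Arguments lf_measure : clear implicits.

Section notions.
Context {R : realType} {d : nat}.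
Local Notation Rd := 'rV[R]_d.
Local Notation lambda := (lebesgue_rV R d).
Local Open Scope ereal_scope.

(* mu( . | A); only meant for 0 < mu A < +oo (it is 0 when mu A is 0 or +oo). *)
Definition cond_measure dT (T : measurableType dT) (mu : set T -> \bar R)
  (A B : set T) : \bar R := mu (B `&` A) / mu A.

Definition boundary (A : set Rd) : set Rd := closure A `\` interior A.

Definition support (mu : set Rd -> \bar R) : set Rd :=
  [set x | forall U, open U -> U x -> 0 < mu U].

Definition eq_law dT (T : measurableType dT) dG (G : measurableType dG)
    (Q : {measure set T -> \bar R}) (Y Y' : T -> G) :=
  forall A, measurable A -> pushforward Q Y A = pushforward Q Y' A.

(* kappa (Y _) is a version of the conditional distribution of V given Y under Q. *)
Definition cond_distribution dT (T : measurableType dT)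
    dG (G : measurableType dG) dK (K : measurableType dK)
    (Q : {measure set T -> \bar R}) (V : T -> K) (Y : T -> G)
    (kappa : G -> set K -> \bar R) :=
  forall A B, measurable A -> measurable B ->
    Q (Y @^-1` A `&` V @^-1` B) = \int[Q]_(w in Y @^-1` A) kappa (Y w) B.

Section random_elements.
Context dT (T : measurableType dT) (Q : {measure set T -> \bar R}).

Definition stationary dG (G : measurableType dG) (th : Rd -> G -> G)
  (W : T -> G) := forall t, eq_law Q (fun w => th t (W w)) W.

Definition density_field (H : path_space R d) (xi : T -> lf_measure R d)
    (Z : T -> path_of H) :=
  shift_measurable (@path_shift R d H) /\
  forall w B, measurable B -> xi w B = \int[lambda]_(s in B) (Z w s)%:E.

End random_elements.

Section mass_stationarity.
Context dT (T : measurableType dT) dG (G : measurableType dG).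
Context (th : Rd -> G -> G) (W : T -> G) (xi : T -> lf_measure R d).

Local Notation Wxi := (fun w => (W w, xi w)).
Local Notation thxi := (pair_shift th (@lf_shift R d)).

(* The randomization (U, V) lives on an extension (T', Q', pi) of (T, Q).
   The two conditional distributions determine the law of ((W, xi), U, V), so
   the choice of the extension is immaterial. *)
Definition mass_stationary (Q : {measure set T -> \bar R}) :=
  [/\ sigma_finite setT (pushforward Q Wxi),
      {ae Q, forall w, support (xi w) 0%R} &
      forall C : set Rd, measurable C -> bounded_set C ->
        0 < lambda C -> lambda (boundary C) = 0 ->
      exists (dT' : measure_display) (T' : measurableType dT')
        (Q' : {measure set T' -> \bar R}) (pi : {mfun T' >-> T})
        (U V : {mfun T' >-> Rd}),
      [/\ forall A, measurable A -> pushforward Q' pi A = Q A,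
          cond_distribution Q' U (fun w => Wxi (pi w))
            (fun _ => cond_measure lambda C),
          cond_distribution Q' V (fun w => (Wxi (pi w), U w))
            (fun y => cond_measure y.1.2 [set c - y.2 | c in C]%R) &
          eq_law Q' (fun w => (thxi (V w) (Wxi (pi w)), V w + U w)%R)
                    (fun w => (Wxi (pi w), U w))]].

(* The law of (W, xi) under Q is the Palm measure of the stationary pair
   (W, xi) under P. By stationarity, one B suffices; all B are required. *)
Definition palm_version (Q P : {measure set T -> \bar R}) :=
  stationary P thxi Wxi /\
  forall f : G * lf_measure R d -> \bar R,
    measurable_fun setT f -> (forall y, 0 <= f y) ->
  forall B : set Rd, measurable B -> 0 < lambda B -> lambda B < +oo ->
    \int[Q]_w f (Wxi w) =
    (\int[P]_w \int[xi w]_(t in B) f (thxi t (Wxi w))) / lambda B.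

End mass_stationarity.

(* dZ0P = Z_0 dP *)
Section Z0P.
Context dT (T : measurableType dT) (P : {measure set T -> \bar R}).
Context (H : path_space R d) (Z : {mfun T >-> path_of H}).

Definition Z0P (A : set T) : \bar R := \int[P]_(w in A) (Z w 0%R)%:E.

Let Z0_ge0 w : 0 <= (Z w 0%R)%:E.
Proof. by rewrite lee_fin; exact: (path_set_ge0 (path_funP (Z w))). Qed.

Let Z0P0 : Z0P set0 = 0.
Proof. exact: integral_set0. Qed.

Let Z0P_ge0 A : 0 <= Z0P A.
Proof. by apply: integral_ge0 => w _; exact: Z0_ge0. Qed.

Let Z0P_sigma_additive : semi_sigma_additive Z0P.
Proof.
apply: semi_sigma_additive_nng_induced => //.
apply/measurable_EFinP.
exact: (measurableT_comp (measurable_path_eval 0%R)).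
Qed.

HB.instance Definition _ := isMeasure.Build _ _ _ Z0P
  Z0P0 Z0P_ge0 Z0P_sigma_additive.

End Z0P.

End notions.

(* Main.v *)
(* By Tonelli's theorem and stationarity, E int F(theta_t W, t) dt =
   E int F(W, t) dt for every measurable F >= 0, where W = (X, Z).  Since
   Z_t = Z_0 o theta_t, the choice F(y, t) = f(y) Z_0(y) 1_B(t) is the Palm
   formula.  For mass-stationarity, the law of (W, U, V) has the density
   Z_0 1_C(u)/lambda(C) * Z_v 1_{C-u}(v)/xi(C - u) with respect to
   P x lambda x lambda.  Moving the origin to v turns Z_v into Z_0, Z_0 into
   Z_{-v} and xi(C - u) into xi(C - (u + v)); after the substitution s = u + v,
   integrating Z_{u-s} over u in C produces xi(C - s), which cancels the
   normalisation and leaves the law of (W, U). *)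
Require Import Defs.
From HB Require Import structures.
From mathcomp Require Import all_boot all_order all_algebra.
From mathcomp Require Import all_classical all_reals all_analysis.
From mathcomp Require Import measurable_realfun ring.

Set Implicit Arguments.
Unset Strict Implicit.
Unset Printing Implicit Defensive.

Import Order.TTheory GRing.Theory Num.Def Num.Theory.
Import numFieldNormedType.Exports.

Local Open Scope classical_set_scope.
Local Open Scope ring_scope.

(** * Densities and Tonelli's theorem *)

(** The obstacle is the quotient by [xi (C - u)]: this mass can vanish, the real inverse is then
    [0], and the candidate density of [(W, U, V)] loses mass at such [(w, u)]. Stationarity, used
    once more in [window_mass_null], shows that they are negligible for the law of [(W, U)]; applied
    to small balls, the same fact puts [0] into the support of [xi]. The extension that carries [U]
    and [V] is [T] times two copies of [Rd], with that density and the coordinate projections. A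
    second difficulty is that [xi w] is given by its density on Borel sets only, while stationarity
    is assumed for [W] alone. Measurable sets of measures do not see the other values, so [xi] can
    be exchanged for [field_measure], a measurable function of [W], and stationarity passes to the
    pair. Tonelli's theorem asks for [P] itself to be sigma-finite, which is pulled back from the
    law of [((X, Z), xi)]. The argument runs on a space [G] with a shift [th] and a function [z0] in
    the role of the field at the origin; paths return only in the theorem. *)

Section density.
Local Open Scope ereal_scope.
Context d (T : measurableType d) (R : realType).
Context (mu nu : {measure set T -> \bar R}) (g : T -> R).
Hypotheses (mg : measurable_fun setT g) (g0 : forall x, (0 <= g x)%R).
Hypothesis nuE : forall A, measurable A -> nu A = \int[mu]_(x in A) (g x)%:E.

Let mEg : measurable_fun setT (EFin \o g).
Proof. exact/measurable_EFinP. Qed.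

Let Eg0 x : 0 <= (g x)%:E.
Proof. by rewrite lee_fin. Qed.

Import HBNNSimple.

(** Simple functions and monotone convergence. Only the values of [nu] on measurable sets enter, so
    the same lemma serves [Q], the random measure [xi w] and the joint law [Q']. *)
Lemma ge0_integral_density (f : T -> \bar R) : measurable_fun setT f ->
  (forall x, 0 <= f x) -> \int[nu]_x f x = \int[mu]_x (f x * (g x)%:E).
Proof.
move=> mf f0; pose f_ := nnsfun_approx measurableT mf.
have cvf x : EFin \o f_ ^~ x @ \oo --> f x by exact: cvg_nnsfun_approx.
have mf_ n : measurable_fun setT (fun x => (f_ n x)%:E).
  exact/measurable_EFinP/measurable_funP.
transitivity (limn (fun n => \int[nu]_x (f_ n x)%:E)).
  rewrite -monotone_convergence//.
  - by apply: eq_integral => x _; apply/esym/cvg_lim => //; exact: cvf.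
  - by move=> n x _; rewrite lee_fin.
  - by move=> x _ m n mn; rewrite lee_fin; exact/lefP/nd_nnsfun_approx.
transitivity (limn (fun n => \int[mu]_x ((f_ n x)%:E * (g x)%:E))); last first.
  rewrite -monotone_convergence//; last 3 first.
  - by move=> n; exact: emeasurable_funM.
  - by move=> n x _; rewrite mule_ge0// ?lee_fin.
  - by move=> x _ m n mn; rewrite lee_wpmul2r// lee_fin;
      exact/lefP/nd_nnsfun_approx.
  apply: eq_integral => x _; apply/cvg_lim => //.
  by apply: cvgeZr => //; exact: cvf.
congr (limn _); apply/funext => n.
transitivity (\sum_(k \in range (f_ n)) \int[nu]_x (k * \1_(f_ n @^-1` [set k]) x)%:E).
  under eq_integral do rewrite fimfunE -fsumEFin//.
  rewrite ge0_integral_fsum//.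
  - by move=> y; exact/measurable_EFinP/measurable_funM.
  - by move=> y x _; rewrite nnfun_muleindic_ge0.
transitivity (\sum_(k \in range (f_ n)) \int[mu]_x
    ((k * \1_(f_ n @^-1` [set k]) x)%:E * (g x)%:E)); last first.
  rewrite -ge0_integral_fsum//.
  - apply: eq_integral => x _; rewrite [in RHS]fimfunE -fsumEFin//.
    rewrite ge0_mule_fsuml// => y; exact: nnfun_muleindic_ge0.
  - by move=> y; apply: emeasurable_funM => //; exact/measurable_EFinP/measurable_funM.
  - by move=> y x _; rewrite mule_ge0// nnfun_muleindic_ge0.
apply: eq_fsbigr => k /set_mem[x _ <-].
set y := f_ n x; have y0 : (0 <= y)%R by exact: fun_ge0.
have ind0 z : 0 <= (\1_(f_ n @^-1` [set y]) z : R)%:E by rewrite lee_fin.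
under eq_integral do rewrite EFinM.
rewrite ge0_integralZl_EFin//; last exact/measurable_EFinP.
under [RHS]eq_integral do rewrite EFinM -muleA.
rewrite [RHS]ge0_integralZl_EFin//; last 2 first.
  by move=> z _; rewrite mule_ge0.
  by apply: emeasurable_funM => //; exact/measurable_EFinP.
congr (_ * _); rewrite integral_indic// setIT nuE// integral_mkcond.
by apply: eq_integral => z _; rewrite epatch_indic muleC.
Qed.

End density.

Section integral_facts.
Local Open Scope ereal_scope.
Context d (T : measurableType d) (R : realType) (mu : {measure set T -> \bar R}).

Section density_measure.
Variable g : T -> R.
Hypotheses (mg : measurable_fun setT g) (g0 : forall x, (0 <= g x)%R).

Definition density_fun (A : set T) : \bar R := \int[mu]_(x in A) (g x)%:E.

Let density0 : density_fun set0 = 0.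
Proof. exact: integral_set0. Qed.

Let density_ge0 A : 0 <= density_fun A.
Proof. by apply: integral_ge0 => x _; rewrite lee_fin. Qed.

Let density_sigma_additive : semi_sigma_additive density_fun.
Proof.
apply: semi_sigma_additive_nng_induced => [|x]; last by rewrite lee_fin.
exact/measurable_EFinP.
Qed.

HB.instance Definition _ := isMeasure.Build _ _ _ density_fun
  density0 density_ge0 density_sigma_additive.

Definition density_measure : {measure set T -> \bar R} := density_fun.

End density_measure.

Lemma ge0_integralZl_real (k : R) (f : T -> R) : (0 <= k)%R ->
  measurable_fun setT f -> (forall x, (0 <= f x)%R) ->
  \int[mu]_x (k * f x)%:E = k%:E * \int[mu]_x (f x)%:E.
Proof.
move=> k0 mf f0; under eq_integral do rewrite EFinM.
rewrite ge0_integralZl_EFin//; last exact/measurable_EFinP.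
by move=> x _; rewrite lee_fin.
Qed.

Lemma integral_indicE (A : set T) : measurable A ->
  \int[mu]_x (\1_A x)%:E = mu A.
Proof. by move=> mA; rewrite integral_indic// setIT. Qed.

(** Sigma-finiteness of [mu] is a hypothesis and not part of its type, because for [P] it is derived
    from the law of the random elements; the structure is packed inside the proof. *)
Lemma sigma_finite_fubini_tonelli d' (S : measurableType d')
    (m : {sigma_finite_measure set S -> \bar R}) (f : T * S -> \bar R) :
  sigma_finite setT mu -> measurable_fun setT f -> (forall p, 0 <= f p) ->
  \int[mu]_x \int[m]_s f (x, s) = \int[m]_s \int[mu]_x f (x, s).
Proof.
move=> smu mf f0.
pose mu' : {sigma_finite_measure set T -> \bar R} :=
  HB.pack_for (SigmaFiniteMeasure.type T R) (Measure.sort mu)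
    (isSFinite.Build _ _ _ _ (sfinite_measure_sigma_finite smu))
    (isSigmaFinite.Build _ _ _ _ smu).
exact: (fubini_tonelli (m1 := mu') (m2 := m)).
Qed.

Lemma sigma_finite_fubini_tonelli1 d' (S : measurableType d')
    (m : {sigma_finite_measure set S -> \bar R}) (f : T * S -> \bar R) :
  sigma_finite setT mu -> measurable_fun setT f -> (forall p, 0 <= f p) ->
  \int[mu \x m]_p f p = \int[mu]_x \int[m]_s f (x, s).
Proof.
move=> smu mf f0.
pose mu' : {sigma_finite_measure set T -> \bar R} :=
  HB.pack_for (SigmaFiniteMeasure.type T R) (Measure.sort mu)
    (isSFinite.Build _ _ _ _ (sfinite_measure_sigma_finite smu))
    (isSigmaFinite.Build _ _ _ _ smu).
exact: (fubini_tonelli1 (m1 := mu') (m2 := m)).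
Qed.

(** For nonnegative [f] the inverse is the power with exponent [-1], including the value [0] at
    [0]. *)
Lemma measurable_funV (f : T -> R) : measurable_fun setT f ->
  (forall x, (0 <= f x)%R) -> measurable_fun setT (fun x => (f x)^-1)%R.
Proof.
move=> mf f0; under eq_fun do rewrite -powR_inv1//.
exact: (measurableT_comp (@measurable_powR R _) mf).
Qed.

Lemma measurable_indic_comp d' (S : measurableType d') (A : set S) (f : T -> S) :
  measurable A -> measurable_fun setT f ->
  measurable_fun setT (fun x => \1_A (f x) : R).
Proof. by move=> mA mf; exact: (measurableT_comp (measurable_indic mA)). Qed.

Lemma product_sigma_finite d' (S : measurableType d')
    (m : {sigma_finite_measure set S -> \bar R}) :
  sigma_finite setT mu -> sigma_finite setT (mu \x m).
Proof.
move=> /sigma_finiteP[F [TF ndF Foo]].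
have /sigma_finiteP[H [TH ndH Hoo]] := sigma_finiteT m.
exists (fun n => F n `*` H n) => [|n].
  apply/seteqP; split=> // -[x y] _.
  have [[n _ Fx] [k _ Hy]] : (\bigcup_i F i) x /\ (\bigcup_i H i) y.
    by rewrite -TF -TH.
  exists (maxn n k) => //; split.
  - by move: x Fx; exact/subsetPset/ndF/leq_maxl.
  - by move: y Hy; exact/subsetPset/ndH/leq_maxr.
have [mF Fn] := Foo n; have [mH Hn] := Hoo n.
split; first exact: measurableX.
by rewrite product_measure1E// lte_mul_pinfty// ge0_fin_numE.
Qed.

End integral_facts.

(** * Lebesgue measure on R^d *)

Section lebesgue_rV.
Context {R : realType}.
Local Open Scope ereal_scope.

Lemma measurable_addr_measurableTypeR (t : R) :
  measurable_fun setT (fun x : measurableTypeR R => (x + t)%R : measurableTypeR R).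
Proof. exact: measurable_funD. Qed.

(** Uniqueness of Lebesgue measure: the translated measure has the same values on half-open
    intervals. *)
Lemma lebesgue_measureD (t : R) A : measurable A ->
  lebesgue_measure ((fun x : measurableTypeR R => (x + t)%R) @^-1` A)
  = lebesgue_measure A.
Proof.
move=> mA; apply/esym.
pose m := measure_function_pushforward__canonical__measure_function_Measure
  (@lebesgue_measure R) (measurable_addr_measurableTypeR t).
apply: (@lebesgue_measure_unique R m) => // _ [[a b] _ <-].
rewrite /= /pushforward.
rewrite (_ : _ @^-1` _ = `](a - t)%R, (b - t)%R]%classic); last first.
  by apply/seteqP; split => x /=; rewrite !in_itv/= ltrBlDr lerBrDr.
rewrite !lebesgue_measure_itv/= !lte_fin ltrD2r.
by case: ifPn => // _; rewrite -!EFinB opprD addrACA subrr addr0.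
Qed.

Lemma ge0_integral_translation (f : measurableTypeR R -> \bar R) t :
  measurable_fun setT f -> (forall x, 0 <= f x) ->
  \int[lebesgue_measure]_x f (x + t)%R = \int[lebesgue_measure]_x f x.
Proof.
move=> mf f0.
have := @ge0_integral_pushforward _ _ _ _ R _ (measurable_addr_measurableTypeR t)
  lebesgue_measure setT f measurableT mf (fun x _ => f0 x).
rewrite preimage_setT => <-; apply: eq_measure_integral => /=.
  exact: measurable_addr_measurableTypeR.
by move=> ? A mA _; exact: lebesgue_measureD.
Qed.

Lemma ge0_integral_lebesgue_step d (m : {sigma_finite_measure set 'rV[R]_d -> \bar R})
    (f : 'rV[R]_d.+1 -> \bar R) :
  measurable_fun setT f -> (forall x, 0 <= f x) ->
  \int[lebesgue_step m]_x f x =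
  \int[lebesgue_measure]_x \int[m]_v f (cons_rV (x, v)).
Proof.
move=> mf f0.
rewrite (ge0_integral_pushforward (@measurable_cons_rV R d))//.
rewrite preimage_setT fubini_tonelli1//.
  exact: measurableT_comp mf (@measurable_cons_rV R d).
by move=> x; exact: f0.
Qed.

Lemma cons_rVD d (x y : R) (u v : 'rV[R]_d) :
  (cons_rV (x, u) + cons_rV (y, v) = cons_rV (x + y, u + v))%R.
Proof. by rewrite /cons_rV/= [LHS](@add_row_mx _ 1 1 d) -raddfD. Qed.

Lemma uncons_rVK d : cancel (@uncons_rV R d) (@cons_rV R d).
Proof.
move=> v; apply/rowP => i; rewrite /cons_rV.
case: (@split_ordP 1 d i) => j ->.
  by rewrite (@row_mxEl _ 1 1 d) !mxE !ord1/= mulr1n; congr (v _ _); exact/val_inj.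
by rewrite (@row_mxEr _ 1 1 d) mxE.
Qed.

Lemma measurable_coord_rV d (i : 'I_d) :
  measurable_fun setT (fun v : 'rV[R]_d => v ord0 i).
Proof.
by apply: continuous_measurable_rV => v; exact: (@coord_continuous R 1 d ord0 i v).
Qed.

Lemma measurable_fun_rV_coord d dT (T : measurableType dT) (f : T -> 'rV[R]_d) :
  (forall i, measurable_fun setT (fun x => f x ord0 i)) -> measurable_fun setT f.
Proof.
elim: d f => [|d IH] f mf.
  rewrite (_ : f = cst 0%R); first exact: measurable_cst.
  by apply/funext => x; apply/rowP => -[].
rewrite (_ : f = @cons_rV R d \o (fun x => (f x ord0 ord0, @rsubmx _ 1 1 d (f x)))).
  apply: measurableT_comp; first exact: measurable_cons_rV.
  apply: measurable_fun_pair => /=; first exact: mf.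
  by apply: IH => i; under eq_fun do rewrite mxE; exact: mf.
by apply/funext => x /=; rewrite -[LHS]uncons_rVK.
Qed.

Lemma measurable_funD_rV d dT (T : measurableType dT) (f g : T -> 'rV[R]_d) :
  measurable_fun setT f -> measurable_fun setT g ->
  measurable_fun setT (fun x => f x + g x)%R.
Proof.
move=> mf mg; apply: measurable_fun_rV_coord => i.
under eq_fun do rewrite mxE.
by apply: measurable_funD; apply: measurableT_comp (measurable_coord_rV i) _.
Qed.

Lemma measurable_funN_rV d dT (T : measurableType dT) (f : T -> 'rV[R]_d) :
  measurable_fun setT f -> measurable_fun setT (fun x => - f x)%R.
Proof.
move=> mf; apply: measurable_fun_rV_coord => i.
under eq_fun do rewrite mxE.
apply: measurableT_comp; first exact: oppr_measurable.
exact: measurableT_comp (measurable_coord_rV i) mf.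
Qed.

(** Induction on the dimension, splitting off the first coordinate of both the variable and [t]: the
    inner integral is invariant by induction, the outer one by the case of the line. In dimension
    [0] there is a single point. *)
Lemma ge0_integral_rV_translation d (f : 'rV[R]_d -> \bar R) t :
  measurable_fun setT f -> (forall x, 0 <= f x) ->
  \int[lebesgue_rV R d]_x f (x + t)%R = \int[lebesgue_rV R d]_x f x.
Proof.
elim: d f t => [|d IH] f t mf f0.
  by apply: eq_integral => x _; congr f; apply/rowP => -[].
have mft : measurable_fun setT (fun x : 'rV[R]_d.+1 => f (x + t)%R).
  apply: (measurableT_comp mf); exact: measurable_funD_rV.
have stepE g (mg : measurable_fun setT g) (g0 : forall x, 0 <= g x) :=
  ge0_integral_lebesgue_step (lebesgue_rV R d) mg g0.
have [Et Ef] := (stepE _ mft (fun x => f0 _), stepE _ mf f0).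
rewrite -[LHS]/(\int[lebesgue_step (lebesgue_rV R d)]_x f (x + t)%R).
rewrite -[RHS]/(\int[lebesgue_step (lebesgue_rV R d)]_x f x) {}Et {}Ef.
rewrite -[t]uncons_rVK; case: (uncons_rV t) => t0 t1.
under eq_integral do under eq_integral do rewrite cons_rVD.
have mfc : measurable_fun setT (f \o @cons_rV R d).
  exact: measurableT_comp mf (@measurable_cons_rV R d).
under eq_integral => x _.
  rewrite (IH (fun v => f (cons_rV (x + t0, v)%R)))//; last first.
    exact: (measurableT_comp mfc (measurable_pair1 _)).
  over.
rewrite (ge0_integral_translation
  (f := fun x => \int[lebesgue_rV R d]_v f (cons_rV (x, v))))//.
- apply: (measurable_fun_fubini_tonelli_F (f \o @cons_rV R d)) => // x; exact: f0.
- by move=> x; apply: integral_ge0 => v _; exact: f0.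
Qed.

Lemma preimage_cons_rV_ball d (r : R) :
  @cons_rV R d @^-1` (ball 0%R r) = ball 0%R r `*` ball 0%R r.
Proof.
apply/seteqP; split => [[x v] [r0 xv]|[x v] [/= x0 [r0 v0]]]; split => //=.
- have := xv ord0 (lshift d (ord0 : 'I_1)).
  by rewrite (@row_mxEl _ 1 1 d) !mxE eqxx.
- split => // i j; have := xv i (rshift 1 j).
  by rewrite (@row_mxEr _ 1 1 d) !mxE.
- move=> i k; rewrite (ord1 i); case: (@split_ordP 1 d k) => j ->.
    by rewrite (@row_mxEl _ 1 1 d) !mxE !ord1.
  by rewrite (@row_mxEr _ 1 1 d) !mxE; have := v0 ord0 j; rewrite mxE.
Qed.

Lemma measurable_ball_rV d (x : 'rV[R]_d) (r : R) : measurable (ball x r).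
Proof.
by apply: open_measurable_rV; exact: (@ball_open R ('rV[R]_d : normedModType R)).
Qed.

(** Balls of the sup norm are cubes of side [r *+ 2], hence products over the coordinates. *)
Lemma lebesgue_rV_ball d (r : R) : (0 < r)%R ->
  lebesgue_rV R d (ball 0%R r) = ((r *+ 2) ^+ d)%:E.
Proof.
move=> r0; elim: d => [|d IH].
  rewrite /= diracE expr0 mem_set//; exact: ballxx.
rewrite /= /lebesgue_step /pushforward preimage_cons_rV_ball.
rewrite product_measure1E//; last 2 first.
- exact: (@measurable_ball R).
- exact: measurable_ball_rV.
rewrite exprS EFinM -IH; congr (_ * _).
by apply: lebesgue_measure_ball; exact: ltW.
Qed.

Lemma bounded_set_rV_ball d (C : set 'rV[R]_d) : bounded_set C ->
  exists n : nat, C `<=` ball 0%R n%:R.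
Proof.
move=> [M [_ CM]]; exists (truncn (`|M| + 1)%R).+1 => x Cx.
have -> : ball (0 : 'rV[R]_d)%R (truncn (`|M| + 1)%R).+1%:R x <->
  (`|x| < (truncn (`|M| + 1)%R).+1%:R)%R.
  by rewrite -ball_normE/= sub0r normrN.
apply: le_lt_trans (truncnS_gt _); apply: CM => //.
by rewrite (le_lt_trans (ler_norm _))// ltrDl.
Qed.

Lemma lebesgue_rV_bounded d (C : set 'rV[R]_d) : measurable C -> bounded_set C ->
  lebesgue_rV R d C < +oo.
Proof.
move=> mC /bounded_set_rV_ball[n Cn].
apply: le_lt_trans (_ : lebesgue_rV R d (ball 0%R n.+1%:R) < +oo).
  apply: le_measure; rewrite ?inE//; first exact: measurable_ball_rV.
  by apply: subset_trans Cn _; apply: le_ball; rewrite ler_nat.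
by rewrite lebesgue_rV_ball// ltry.
Qed.

End lebesgue_rV.

(** * Random measures with a density field *)

Section lf_measure_facts.
Context {R : realType} {d : nat}.
Local Notation Rd := 'rV[R]_d.
Implicit Types mu nu : lf_measure R d.
Local Open Scope ereal_scope.

Lemma measurable_fun_lf dT (T : measurableType dT) (f : T -> lf_measure R d) :
  (forall B, measurable B -> measurable_fun setT (fun x => f x B)) ->
  measurable_fun setT f.
Proof.
move=> mf; apply: (@measurability _ _ T (lf_measure R d) setT f
  (\bigcup_(B in measurable) preimage_set_system setT
     (fun mu : lf_measure R d => mu B) measurable)) => //.
move=> _ [_ [B mB [Y mY <-]] <-]; rewrite setTI.
by rewrite setTI; have := mf B mB measurableT Y mY; rewrite setTI.
Qed.

Definition eq_on_measurable mu nu := forall B, measurable B -> mu B = nu B.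

(* An [lf_measure] also has (junk) values on nonmeasurable sets, which its
   sigma-algebra does not see. *)
Lemma lf_measurable_ext mu nu (A : set (lf_measure R d)) :
  eq_on_measurable mu nu -> measurable A -> A mu = A nu.
Proof.
move=> munu; pose S := [set A : set (lf_measure R d) | A mu = A nu].
suff : measurable `<=` S by exact.
apply: smallest_sub.
  split; rewrite /S/=.
  - by [].
  - by move=> B BE; rewrite /setD/= BE.
  - by move=> F FE; apply/propext; split => -[n _ Fn]; exists n => //;
      move: Fn; rewrite FE.
by move=> _ [B mB [Y mY <-]]; rewrite /S/= munu.
Qed.

Lemma lf_measurable_fun_ext mu nu (f : lf_measure R d -> \bar R) :
  eq_on_measurable mu nu -> measurable_fun setT f -> f mu = f nu.
Proof.
move=> munu mf.
(* The fibre of [f] through [mu] is measurable, so it contains [nu] as well. *)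
have mA : measurable (f @^-1` [set f mu]).
  by rewrite -[X in measurable X]setTI; apply: mf => //; exact: emeasurable_set1.
by have /= E := lf_measurable_ext munu mA; apply/esym; rewrite -E.
Qed.

End lf_measure_facts.

Section field.
Context {R : realType} {d : nat}.
Local Notation Rd := 'rV[R]_d.
Local Notation lambda := (lebesgue_rV R d).
Local Open Scope ereal_scope.
Context dG (G : measurableType dG) (th : Rd -> G -> G) (z0 : G -> R).
Hypothesis hth : shift_measurable th.
Hypothesis mz0 : measurable_fun setT z0.
Hypothesis z0_ge0 : forall g, (0 <= z0 g)%R.

Definition field (s : Rd) (g : G) : R := z0 (th s g).
Local Notation z := field.

Let thD s t g : th (s + t)%R g = th s (th t g). Proof. by case: hth. Qed.
Let mth : measurable_fun setT (fun p : Rd * G => th p.1 p.2).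
Proof. by case: hth. Qed.

Lemma field_ge0 s g : (0 <= z s g)%R. Proof. exact: z0_ge0. Qed.

Lemma field_shift s t g : z s (th t g) = z (s + t)%R g.
Proof. by rewrite /field thD. Qed.

Lemma measurable_shift dS (S : measurableType dS) (s : S -> Rd) (g : S -> G) :
  measurable_fun setT s -> measurable_fun setT g ->
  measurable_fun setT (fun y => th (s y) (g y)).
Proof.
move=> ms mg; exact: (measurableT_comp mth (measurable_fun_pair ms mg)).
Qed.

Lemma measurable_field dS (S : measurableType dS) (s : S -> Rd) (g : S -> G) :
  measurable_fun setT s -> measurable_fun setT g ->
  measurable_fun setT (fun y => z (s y) (g y)).
Proof. by move=> ms mg; apply: (measurableT_comp mz0); exact: measurable_shift. Qed.

(** Local integrability, tested on countably many balls so that the set is measurable. It is needed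
    because a map from [G] to [lf_measure] must be locally finite at every [g], also outside the
    range of [W]. *)
Definition field_lf : set G :=
  [set g | forall n : nat, \int[lambda]_(s in ball 0%R n%:R) (z s g)%:E < +oo].

(** Taking [B] in the product lets the domain of integration depend on the parameter, as the window
    [C - u] depends on [u]. *)
Lemma measurable_field_integral dS (S : measurableType dS) (B : set (Rd * S))
    (g : S -> G) :
  measurable B -> measurable_fun setT g ->
  measurable_fun setT (fun y => \int[lambda]_s (\1_B (s, y) * z s (g y))%:E).
Proof.
move=> mB mg.
apply: (measurable_fun_fubini_tonelli_G
  (fun p : Rd * S => (\1_B p * z p.1 (g p.2))%:E)) => [|p].
  apply/measurable_EFinP; apply: measurable_funM => //.
  by apply: measurable_field => //; exact: measurableT_comp.
by rewrite lee_fin mulr_ge0// field_ge0.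
Qed.

Lemma field_integral_indic (B : set Rd) g :
  \int[lambda]_(s in B) (z s g)%:E = \int[lambda]_s (\1_B s * z s g)%:E.
Proof.
by rewrite integral_mkcond; apply: eq_integral => s _; rewrite epatch_indic EFinM muleC.
Qed.

Lemma measurable_field_integralT (B : set Rd) : measurable B ->
  measurable_fun setT (fun g => \int[lambda]_(s in B) (z s g)%:E).
Proof.
move=> mB; rewrite (_ : (fun g => _) = (fun g =>
    \int[lambda]_s (\1_(B `*` [set: G]) (s, g) * z s g)%:E)).
  apply: (measurable_field_integral (g := id)) => //; exact: measurableX.
apply/funext => g; rewrite field_integral_indic; apply: eq_integral => s _.
by rewrite !indicE in_setX in_setT andbT.
Qed.

Lemma measurable_field_lf : measurable field_lf.
Proof.
rewrite (_ : field_lf = \bigcap_n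
    [set g | \int[lambda]_(s in ball 0%R n%:R) (z s g)%:E < +oo]); last first.
  by apply/seteqP; split => g h n; [move=> _; exact: h|exact: h].
apply: bigcapT_measurable => n; rewrite -[X in measurable X]setTI.
apply: emeasurable_fun_infty_o => //; apply: measurable_field_integralT.
exact: measurable_ball_rV.
Qed.

Section field_measure.
Variable g : G.

Definition field_measure_fun (B : set Rd) : \bar R :=
  \int[lambda]_(s in B) (\1_field_lf g * z s g)%:E.

Let field_measure0 : field_measure_fun set0 = 0.
Proof. exact: integral_set0. Qed.

Let field_measure_ge0 B : 0 <= field_measure_fun B.
Proof. by apply: integral_ge0 => s _; rewrite lee_fin mulr_ge0// field_ge0. Qed.

Let field_measure_sigma_additive : semi_sigma_additive field_measure_fun.
Proof.
apply: semi_sigma_additive_nng_induced => [|s]; last first.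
  by rewrite lee_fin mulr_ge0// field_ge0.
by apply/measurable_EFinP; apply: measurable_funM => //; exact: measurable_field.
Qed.

HB.instance Definition _ := isMeasure.Build _ _ _ field_measure_fun
  field_measure0 field_measure_ge0 field_measure_sigma_additive.

Let field_measure_lf (B : set Rd) : measurable B -> bounded_set B ->
  field_measure_fun B < +oo.
Proof.
move=> mB bB; rewrite /field_measure_fun.
have [gl|gl] := pselect (field_lf g); last first.
  rewrite integral0_eq// => s _; rewrite indicE memNset// mul0r//.
have [n Bn] := bounded_set_rV_ball bB.
apply: le_lt_trans (gl n).
under eq_integral do rewrite indicE mem_set// mul1r.
apply: ge0_subset_integral => //; first exact: measurable_ball_rV.
  by apply/measurable_EFinP/measurable_funTS; exact: measurable_field.
by move=> s _; rewrite lee_fin field_ge0.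
Qed.

(* Truncated to the zero measure when the field is not locally integrable. *)
Definition field_measure : lf_measure R d := LfMeasure field_measure_lf.

End field_measure.

Lemma measurable_field_measure : measurable_fun setT field_measure.
Proof.
apply: measurable_fun_lf => B mB.
have -> : (fun g => field_measure g B) = (fun g => \int[lambda]_s
    (\1_(B `*` field_lf) (s, g) * z s g)%:E).
  apply/funext => g; rewrite /= /field_measure_fun integral_mkcond.
  apply: eq_integral => s _; rewrite epatch_indic -EFinM; congr (_%:E).
  by rewrite !indicE in_setX mulrAC -natrM mulnb andbC.
apply: (measurable_field_integral (g := id)) => //.
by apply: measurableX => //; exact: measurable_field_lf.
Qed.

Lemma field_measureE (mu : lf_measure R d) g :
  (forall B, measurable B -> mu B = \int[lambda]_(s in B) (z s g)%:E) ->
  eq_on_measurable mu (field_measure g).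
Proof.
move=> muE B mB; rewrite muE//= /field_measure_fun.
(* Local finiteness of [mu] makes the truncation in [field_measure] inactive at [g]. *)
have gl : field_lf g.
  move=> n; rewrite -muE; last exact: measurable_ball_rV.
  apply: lf_measP; first exact: measurable_ball_rV.
  exists n%:R; split; first exact: num_real.
  move=> x nx y; rewrite -ball_normE/= sub0r normrN => yn.
  exact: ltW (lt_trans yn nx).
by under [RHS]eq_integral do rewrite indicE mem_set// mul1r.
Qed.

(** Covariance of the density: the substitution of [s + t] for [s] turns [z (s + t) g] into
    [z s (th t g)], by the flow property of [th]. *)
Lemma lf_shift_density (mu : lf_measure R d) g t :
  (forall B, measurable B -> mu B = \int[lambda]_(s in B) (z s g)%:E) ->
  forall B, measurable B -> lf_shift t mu B =
    \int[lambda]_(s in B) (z s (th t g))%:E.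
Proof.
move=> muE B mB; rewrite /= /pushforward muE; last first.
  by rewrite -[X in measurable X]setTI; exact: measurable_sub_rV.
rewrite !field_integral_indic.
rewrite -(ge0_integral_rV_translation t).
- apply: eq_integral => s _; rewrite field_shift; congr (_ * _)%:E.
  by rewrite -[LHS]/(\1_B (s + t - t)%R) addrK.
- apply/measurable_EFinP; apply: measurable_funM; last exact: measurable_field.
  apply: measurable_indic; rewrite -[X in measurable X]setTI.
  exact: measurable_sub_rV.
- by move=> x; rewrite lee_fin mulr_ge0// field_ge0.
Qed.

End field.

(** * Stationarity and the Palm version *)

Section stationary_field.
Context {R : realType} {d : nat}.
Local Notation Rd := 'rV[R]_d.
Local Notation lambda := (lebesgue_rV R d).
Local Open Scope ereal_scope.
Context dG (G : measurableType dG) (th : Rd -> G -> G) (z0 : G -> R).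
Hypothesis hth : shift_measurable th.
Hypothesis mz0 : measurable_fun setT z0.
Hypothesis z0_ge0 : forall g, (0 <= z0 g)%R.
Local Notation z := (field th z0).

Context dT (T : measurableType dT) (P : {measure set T -> \bar R}).
Context (W : T -> G) (xi : T -> lf_measure R d).
Hypothesis mW : measurable_fun setT W.
Hypothesis mxi : measurable_fun setT xi.
Hypothesis xiE : forall w B, measurable B ->
  xi w B = \int[lambda]_(s in B) (z s (W w))%:E.
Hypothesis sP : sigma_finite setT P.
Hypothesis statW : stationary P th W.

Local Notation Wxi := (fun w => (W w, xi w)).
Local Notation thxi := (pair_shift th (@lf_shift R d)).
Local Notation Phi := (field_measure hth mz0 z0_ge0).

Lemma stationary_integral (f : G -> \bar R) t :
  measurable_fun setT f -> (forall g, 0 <= f g) ->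
  \int[P]_w f (th t (W w)) = \int[P]_w f (W w).
Proof.
move=> mf f0.
have mthW : measurable_fun setT (fun w => th t (W w)) by exact: measurable_shift.
have -> : \int[P]_w f (th t (W w)) =
    \int[pushforward P (fun w => th t (W w))]_y f y.
  by rewrite (ge0_integral_pushforward mthW).
have -> : \int[P]_w f (W w) = \int[pushforward P W]_y f y.
  by rewrite (ge0_integral_pushforward mW).
by apply: eq_measure_integral => A mA _; exact: statW.
Qed.

(** For fixed [s] the shift by [tau s] is deterministic, so stationarity applies as soon as
    Tonelli's theorem has moved the integral over [P] inside. The uses are [tau := id] for the Palm
    formula, [tau := -%R] for windows of zero mass, and [tau := snd] for moving the origin to
    [V]. *)
Lemma stationary_fubini dS (S : measurableType dS)
    (m : {sigma_finite_measure set S -> \bar R}) (tau : S -> Rd)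
    (F : G * S -> \bar R) :
  measurable_fun setT tau -> measurable_fun setT F -> (forall p, 0 <= F p) ->
  \int[P]_w \int[m]_s F (th (tau s) (W w), s) = \int[P]_w \int[m]_s F (W w, s).
Proof.
move=> mtau mF F0.
transitivity (\int[m]_s \int[P]_w F (th (tau s) (W w), s)).
  apply: (@sigma_finite_fubini_tonelli _ _ _ P _ _ m
    (fun p => F (th (tau p.2) (W p.1), p.2)) sP) => [|p]; last exact: F0.
  apply: (measurableT_comp mF); apply: measurable_fun_pair => //.
  by apply: measurable_shift => //; exact: measurableT_comp.
transitivity (\int[m]_s \int[P]_w F (W w, s)); last first.
  apply/esym/(@sigma_finite_fubini_tonelli _ _ _ P _ _ m
    (fun p => F (W p.1, p.2)) sP) => [|p]; last exact: F0.
  apply: (measurableT_comp mF); apply: measurable_fun_pair => //.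
  exact: measurableT_comp.
apply: eq_integral => s _.
apply: (stationary_integral (f := fun y => F (y, s))) => [|y]; last exact: F0.
exact: (measurableT_comp mF (measurable_pair2 s)).
Qed.

Lemma eq_field_measure w : eq_on_measurable (xi w) (Phi (W w)).
Proof. by apply: field_measureE => B mB; exact: xiE. Qed.

Lemma eq_field_measure_shift t w :
  eq_on_measurable (lf_shift t (xi w)) (Phi (th t (W w))).
Proof.
apply: field_measureE => B mB; apply: lf_shift_density => // C mC; exact: xiE.
Qed.

(** A measurable function of [W] alone that measurable sets and functions cannot distinguish from
    [(W, xi)], nor its shifts from those of the pair. *)
Definition with_field_measure (y : G) : G * lf_measure R d := (y, Phi y).

Lemma measurable_with_field_measure : measurable_fun setT with_field_measure.
Proof. by apply: measurable_fun_pair => //; exact: measurable_field_measure. Qed.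

Lemma measurable_section1 d1 d2 (T1 : measurableType d1) (T2 : measurableType d2)
  (A : set (T1 * T2)) x : measurable A -> measurable [set y | A (x, y)].
Proof.
move=> mA; rewrite -[X in measurable X]setTI.
exact: (measurable_pair1 x measurableT mA).
Qed.

Lemma field_measure_setE (A : set (G * lf_measure R d)) w : measurable A ->
  A (Wxi w) = A (with_field_measure (W w)).
Proof.
move=> mA.
exact: (lf_measurable_ext (eq_field_measure w) (measurable_section1 (W w) mA)).
Qed.

Lemma field_measure_shift_setE (A : set (G * lf_measure R d)) t w :
  measurable A -> A (thxi t (Wxi w)) = A (with_field_measure (th t (W w))).
Proof.
move=> mA; exact: (lf_measurable_ext (@eq_field_measure_shift t w)
  (measurable_section1 (th t (W w)) mA)).
Qed.

Lemma field_measure_funE (f : G * lf_measure R d -> \bar R) w :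
  measurable_fun setT f -> f (Wxi w) = f (with_field_measure (W w)).
Proof.
move=> mf; apply: (lf_measurable_fun_ext (f := fun mu => f (W w, mu))).
  exact: eq_field_measure.
exact: measurableT_comp mf (measurable_pair1 _).
Qed.

Lemma field_measure_shift_funE (f : G * lf_measure R d -> \bar R) t w :
  measurable_fun setT f ->
  f (thxi t (Wxi w)) = f (with_field_measure (th t (W w))).
Proof.
move=> mf; apply: (lf_measurable_fun_ext (f := fun mu => f (th t (W w), mu))).
  exact: eq_field_measure_shift.
exact: measurableT_comp mf (measurable_pair1 _).
Qed.

Lemma stationary_with_measure : stationary P thxi Wxi.
Proof.
move=> t A mA; rewrite /pushforward.
have mA' : measurable (with_field_measure @^-1` A).
  by rewrite -[X in measurable X]setTI; exact: measurable_with_field_measure.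
have := statW t mA'; rewrite /pushforward.
congr (_ = _); congr (P _); apply/funext => w /=.
  by rewrite -field_measure_shift_setE.
by rewrite -field_measure_setE.
Qed.

Variable Q : {measure set T -> \bar R}.
Hypothesis QE : forall A, measurable A -> Q A = \int[P]_(w in A) (z0 (W w))%:E.

Let mz0W : measurable_fun setT (fun w => z0 (W w)).
Proof. exact: measurableT_comp. Qed.

Lemma palm_version_field : palm_version th W xi Q P.
Proof.
split; first exact: stationary_with_measure.
move=> f mf f0 B mB B0 Boo.
pose g y := f (with_field_measure y).
have mg : measurable_fun setT g.
  exact: measurableT_comp mf measurable_with_field_measure.
have g0 y : 0 <= g y by exact: f0.
have mWxi : measurable_fun setT Wxi by exact: measurable_fun_pair.
have -> : \int[Q]_w f (Wxi w) = \int[P]_w (g (W w) * (z0 (W w))%:E).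
  rewrite (ge0_integral_density mz0W _ QE)//; last exact: measurableT_comp mf mWxi.
  by apply: eq_integral => w _; rewrite field_measure_funE.
pose F (p : G * Rd) := g p.1 * (\1_B p.2 * z0 p.1)%:E.
have mF : measurable_fun setT F.
  apply: emeasurable_funM; first exact: measurableT_comp.
  apply/measurable_EFinP; apply: measurable_funM; last exact: measurableT_comp.
  exact: measurable_indic_comp.
have F0 p : 0 <= F p by rewrite mule_ge0// lee_fin mulr_ge0.
have -> : \int[P]_w \int[xi w]_(t in B) f (thxi t (Wxi w)) =
    \int[P]_w \int[lambda]_t F (th t (W w), t).
  apply: eq_integral => w _; rewrite integral_mkcond.
  have mthW : measurable_fun setT (fun t => th t (W w)).
    by apply: measurable_shift => //; exact: measurable_cst.
  have mzW : measurable_fun setT (fun t => z t (W w)).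
    by apply: (measurableT_comp mz0).
  transitivity (\int[xi w]_t (g (th t (W w)) * (\1_B t)%:E)).
    apply: eq_integral => t _; rewrite epatch_indic; congr (_ * _).
    exact: field_measure_shift_funE.
  rewrite (@ge0_integral_density _ _ R lambda (xi w) (fun t => z t (W w)))//.
  - by apply: eq_integral => t _; rewrite /F/= EFinM muleA.
  - by move=> t; exact: field_ge0.
  - by move=> A mA; exact: xiE.
  - apply: emeasurable_funM; first exact: measurableT_comp.
    by apply/measurable_EFinP; exact: measurable_indic.
  - by move=> t; rewrite mule_ge0// lee_fin.
rewrite (stationary_fubini lambda (tau := id) (F := F))//.
have -> : \int[P]_w \int[lambda]_t F (W w, t) =
    \int[P]_w (g (W w) * (z0 (W w))%:E * lambda B).
  apply: eq_integral => w _; rewrite /F/=.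
  under eq_integral do rewrite mulrC EFinM muleA.
  rewrite ge0_integralZl//; last 2 first.
  - by apply/measurable_EFinP; exact: measurable_indic.
  - by rewrite mule_ge0// lee_fin.
  by rewrite integral_indicE.
rewrite ge0_integralZr//; last 2 first.
- by apply: emeasurable_funM; [exact: measurableT_comp|exact/measurable_EFinP].
- by move=> w _; rewrite mule_ge0// lee_fin.
rewrite -muleA; move: B0 Boo; case: (lambda B) => //= r r0 _.
by rewrite inver gt_eqF// -EFinM divff ?gt_eqF// mule1.
Qed.

(** Since [z0] may be unbounded, a set of finite mass under [P] can have infinite mass under [Q].
    Cutting the exhaustion [F] at the level [z0 <= n] bounds the mass under [Q] by [n] times the
    mass of [F n] under [P]. *)
Lemma sigma_finite_law :
  sigma_finite setT (pushforward P Wxi) -> sigma_finite setT (pushforward Q Wxi).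
Proof.
have mWxi : measurable_fun setT Wxi by exact: measurable_fun_pair.
pose m := measure_function_pushforward__canonical__measure_function_Measure P mWxi.
move=> sPW; have /sigma_finiteP[F [FT ndF Foo]] : sigma_finite setT m := sPW.
pose E n := F n `&` [set y | (z0 y.1 <= n%:R)%R].
have mz01 : measurable_fun setT (fun y : G * lf_measure R d => z0 y.1).
  exact: measurableT_comp.
have mE n : measurable (E n).
  apply: measurableI; first by case: (Foo n).
  rewrite -[X in measurable X]setTI.
  by apply: measurable_fun_le => //; exact: measurable_cst.
exists E => [|n].
  apply/seteqP; split => // y _.
  have [k _ Fk] : (\bigcup_i F i) y by rewrite -FT.
  exists (maxn k (truncn (z0 y.1)).+1) => //; split.
    have : F k `<=` F (maxn k (truncn (z0 y.1)).+1).
      exact/subsetPset/ndF/leq_maxl.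
    exact.
  rewrite /= (le_trans (ltW (truncnS_gt _)))// ler_nat; exact: leq_maxr.
split=> //; rewrite /pushforward QE; last first.
  by rewrite -[X in measurable X]setTI; exact: (mWxi measurableT).
have mEn : measurable (Wxi @^-1` E n).
  by rewrite -[X in measurable X]setTI; exact: (mWxi measurableT).
apply: (@le_lt_trans _ _ (\int[P]_(w in Wxi @^-1` E n) (cst n%:R%:E) w)).
  apply: ge0_le_integral => //.
  - by move=> w _; rewrite lee_fin.
  - exact/measurable_EFinP/measurable_funTS.
  - by move=> w [_ /=]; rewrite lee_fin.
rewrite integral_cst// lte_mul_pinfty//.
apply: (@le_lt_trans _ _ (P (Wxi @^-1` F n))).
  apply: le_measure; rewrite ?inE//; last by move=> w [].
  by rewrite -[X in measurable X]setTI; apply: (mWxi measurableT); case: (Foo n).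
by case: (Foo n).
Qed.

End stationary_field.

(** * Masses of the windows C - u, and the origin in the support *)

Section window_mass.
Context {R : realType} {d : nat}.
Local Notation Rd := 'rV[R]_d.
Local Notation lambda := (lebesgue_rV R d).
Local Open Scope ereal_scope.
Context dG (G : measurableType dG) (th : Rd -> G -> G) (z0 : G -> R).
Hypothesis hth : shift_measurable th.
Hypothesis mz0 : measurable_fun setT z0.
Hypothesis z0_ge0 : forall g, (0 <= z0 g)%R.
Local Notation z := (field th z0).

Context dT (T : measurableType dT) (P : {measure set T -> \bar R}).
Context (W : T -> G) (xi : T -> lf_measure R d).
Hypothesis mW : measurable_fun setT W.
Hypothesis xiE : forall w B, measurable B ->
  xi w B = \int[lambda]_(s in B) (z s (W w))%:E.
Hypothesis sP : sigma_finite setT P.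
Hypothesis statW : stationary P th W.
Variable Q : {measure set T -> \bar R}.
Hypothesis QE : forall A, measurable A -> Q A = \int[P]_(w in A) (z0 (W w))%:E.

Let th0 g : th 0%R g = g. Proof. by case: hth. Qed.

Implicit Types (C B : set Rd) (u v : Rd).

(* [xi (C - u)] *)
Definition window_mass C u (g : G) : \bar R :=
  \int[lambda]_s (\1_C (s + u)%R * z s g)%:E.

Lemma window_mass_ge0 C u g : 0 <= window_mass C u g.
Proof. by apply: integral_ge0 => s _; rewrite lee_fin mulr_ge0// z0_ge0. Qed.

Lemma measurable_preimageD C u : measurable C ->
  measurable ((fun s : Rd => s + u)%R @^-1` C).
Proof.
move=> mC; rewrite -[X in measurable X]setTI.
by apply: measurable_funD_rV => //; exact: measurable_cst.
Qed.

Lemma image_subE C u :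
  [set c - u | c in C]%R = (fun s : Rd => s + u)%R @^-1` C.
Proof.
apply/seteqP; split => [_ [c Cc <-]|s Cs] /=; first by rewrite subrK.
by exists (s + u)%R => //; rewrite addrK.
Qed.

Lemma measurable_field1 (g : G) : measurable_fun setT (fun s => z s g).
Proof. by apply: measurable_field => //; exact: measurable_cst. Qed.

Lemma xi_window B C u w : measurable B -> measurable C ->
  xi w (B `&` [set c - u | c in C]%R) =
  \int[lambda]_v (\1_B v * \1_C (v + u)%R * z v (W w))%:E.
Proof.
move=> mB mC; rewrite image_subE xiE; last first.
  by apply: measurableI => //; exact: measurable_preimageD.
rewrite field_integral_indic; apply: eq_integral => s _.
by rewrite indicI.
Qed.

Lemma xi_window_mass C u w : measurable C ->
  xi w [set c - u | c in C]%R = window_mass C u (W w).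
Proof.
move=> mC; rewrite -[X in xi w X]setTI xi_window//.
by apply: eq_integral => s _; rewrite indicT mul1r.
Qed.

Lemma window_mass_fin_num C u w : measurable C -> bounded_set C ->
  window_mass C u (W w) \is a fin_num.
Proof.
move=> mC bC; rewrite ge0_fin_numE ?window_mass_ge0//.
(* The mass of [C - u] is the value at [C] of a shifted measure, which is itself locally finite. *)
have := lf_measP (lf_shift (- u)%R (xi w)) mC bC.
rewrite /= /pushforward -xi_window_mass// image_subE.
by under eq_fun do rewrite opprK.
Qed.

Lemma measurable_window_mass dS (S : measurableType dS) C (u : S -> Rd)
    (g : S -> G) : measurable C -> measurable_fun setT u ->
  measurable_fun setT g ->
  measurable_fun setT (fun y => window_mass C (u y) (g y)).
Proof.
move=> mC mu mg.
apply: (measurable_field_integral hth mz0 z0_ge0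
  (B := (fun p : Rd * S => p.1 + u p.2)%R @^-1` C)) => //.
rewrite -[X in measurable X]setTI; apply: measurable_funD_rV => //.
exact: measurableT_comp.
Qed.

(** Moving the origin to [v] and placing the window relative to [u] amounts to placing it relative
    to [u - v] from the old origin. *)
Lemma window_mass_shift C u v g : measurable C ->
  window_mass C u (th v g) = window_mass C (u - v)%R g.
Proof.
move=> mC; rewrite /window_mass.
rewrite -[RHS](ge0_integral_rV_translation v).
- apply: eq_integral => s _; rewrite field_shift//.
  by congr (\1_C _ * _)%:E; rewrite addrACA subrr addr0 addrC.
- apply/measurable_EFinP; apply: measurable_funM; last exact: measurable_field1.
  apply: measurable_indic_comp => //.
  by apply: measurable_funD_rV => //; exact: measurable_cst.
- by move=> s; rewrite lee_fin mulr_ge0// z0_ge0.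
Qed.

Let mz0W : measurable_fun setT (fun w => z0 (W w)).
Proof. exact: measurableT_comp. Qed.

Let m0 (x : \bar R) : measurable [set x]. Proof. exact: emeasurable_set1. Qed.

(* The mass of [C - u] is shift-covariant, so stationarity replaces
   [Z_0 1{xi (C - u) = 0}] by [Z_u 1{xi C = 0}], whose integral over [u] in [C]
   is [xi C * 1{xi C = 0}]. *)
Lemma window_mass_null C : measurable C ->
  \int[P]_w \int[lambda]_u
    (z0 (W w) * \1_C u * \1_[set 0] (window_mass C u (W w)))%:E = 0.
Proof.
move=> mC.
pose F (p : G * Rd) :=
  (z p.2 p.1 * \1_C p.2 * \1_[set 0] (window_mass C 0%R p.1))%:E.
transitivity (\int[P]_w \int[lambda]_u F (th (- u)%R (W w), u)).
  apply: eq_integral => w _; apply: eq_integral => u _; rewrite /F /=.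
  rewrite window_mass_shift// sub0r opprK field_shift// subrr.
  by rewrite /field th0.
rewrite (stationary_fubini hth mW sP statW lambda (tau := -%R) (F := F)).
- apply: integral0_eq => w _; rewrite /F /=.
  have [X0|X0] := eqVneq (window_mass C 0%R (W w)) 0; last first.
    apply: integral0_eq => u _; rewrite [\1_[set 0] _]indicE memNset ?mulr0//.
    exact/eqP.
  rewrite -X0 /window_mass; apply: eq_integral => u _.
  rewrite -/(window_mass C 0 (W w)) X0 [\1_[set 0] _]indicE mem_set//.
  by rewrite mulr1 addr0 mulrC.
- exact: measurable_funN_rV.
- apply/measurable_EFinP; apply: measurable_funM; last first.
    by apply: measurable_indic_comp => //; exact: measurable_window_mass.
  apply: measurable_funM; first exact: measurable_field.
  exact: measurable_indic_comp.
- by move=> p; rewrite lee_fin !mulr_ge0// z0_ge0.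
Qed.

Lemma measurable_xi B : measurable B -> measurable_fun setT (fun w => xi w B).
Proof.
move=> mB; under eq_fun do rewrite xiE//.
exact: measurableT_comp (measurable_field_integralT hth mz0 z0_ge0 mB) mW.
Qed.

Lemma measurable_xi_eq0 B : measurable B -> measurable [set w | xi w B = 0].
Proof.
move=> mB; rewrite -[X in measurable X]setTI.
exact: (measurable_xi mB measurableT (m0 0)).
Qed.

(** Let [C] be the ball of radius [e / 2]. For [u] in [C] the window [C - u] lies in the ball of
    radius [e], so it has mass zero on the event in question. Hence [lambda C * Q A] is at most the
    integral that vanishes by [window_mass_null], while [lambda C] is positive. *)
Lemma xi_ball_gt0 (e : R) : (0 < e)%R ->
  Q [set w | xi w (ball 0%R e) = 0] = 0.
Proof.
move=> e0; set A := (X in Q X); pose C : set Rd := ball 0%R (e / 2)%R.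
have mC : measurable C by exact: measurable_ball_rV.
have mA : measurable A.
  by apply: measurable_xi_eq0; exact: measurable_ball_rV.
have : lambda C * Q A <= 0; last first.
  rewrite lebesgue_rV_ball ?divr_gt0// => le0.
  apply/eqP; rewrite eq_le measure_ge0 andbT leNgt; apply/negP => QA.
  move: le0; rewrite leNgt => /negP; apply; rewrite mule_gt0// lte_fin.
  by rewrite exprn_gt0// mulrn_wgt0// divr_gt0.
rewrite -(window_mass_null mC).
have -> : lambda C * Q A =
    \int[P]_w \int[lambda]_u (z0 (W w) * \1_A w * \1_C u)%:E.
  rewrite QE// integral_mkcond -ge0_integralZl//; last 2 first.
  - apply/(measurable_restrictT _ _).1 => //.
    by apply/measurable_EFinP; exact: measurable_funTS.
  - by move=> w _; rewrite erestrict_ge0//= => ? _; rewrite lee_fin; exact: z0_ge0.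
  apply: eq_integral => w _.
  rewrite ge0_integralZl_real//; last first.
    by rewrite mulr_ge0.
  by rewrite integral_indicE// epatch_indic -EFinM muleC.
have mI : measurable_fun setT (fun p : T * Rd =>
    (z0 (W p.1) * \1_A p.1 * \1_C p.2)%:E).
  apply/measurable_EFinP; apply: measurable_funM; last exact: measurable_indic_comp.
  apply: measurable_funM; last exact: measurable_indic_comp.
  exact: measurableT_comp mz0W measurable_fst.
have mJ : measurable_fun setT (fun p : T * Rd => (z0 (W p.1) * \1_C p.2 *
    \1_[set 0] (window_mass C p.2 (W p.1)))%:E).
  apply/measurable_EFinP; apply: measurable_funM; last first.
    apply: measurable_indic_comp => //; apply: measurable_window_mass => //.
    exact: measurableT_comp.
  apply: measurable_funM; last exact: measurable_indic_comp.
  exact: measurableT_comp mz0W measurable_fst.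
apply: ge0_le_integral => //.
- by move=> w _; apply: integral_ge0 => u _; rewrite lee_fin !mulr_ge0.
- apply: (measurable_fun_fubini_tonelli_F _ mI) => p.
  by rewrite lee_fin !mulr_ge0.
- apply: (measurable_fun_fubini_tonelli_F _ mJ) => p.
  by rewrite lee_fin !mulr_ge0.
move=> w _; apply: ge0_le_integral => //.
- by move=> u _; rewrite lee_fin !mulr_ge0.
- exact: measurableT_comp mI (measurable_pair1 w).
- exact: measurableT_comp mJ (measurable_pair1 w).
move=> u _; rewrite lee_fin -!mulrA ler_wpM2l// !indicE.
have [/set_mem Aw|_] := boolP (w \in A); last by rewrite mul0r mulr_ge0.
have [/set_mem Cu|_] := boolP (u \in C); last by rewrite mulr0 mul0r.
rewrite mulr1 mul1r; apply: (@le_trans _ _ 1%R) => //.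
rewrite mem_set//= -xi_window_mass//.
apply/eqP; rewrite -measure_le0 -Aw; apply: le_measure; rewrite ?inE.
- by rewrite image_subE; exact: measurable_preimageD.
- exact: measurable_ball_rV.
move=> _ [c Cc <-]; rewrite [e]splitr.
move: Cc Cu; rewrite /C -!ball_normE/= !sub0r !normrN => Cc Cu.
by rewrite (le_lt_trans (ler_normB _ _))// ltrD.
Qed.

Lemma support_xi : {ae Q, forall w, Defs.support (xi w) 0%R}.
Proof.
have h : {ae Q, forall w, forall n, xi w (ball 0%R n.+1%:R^-1) != 0}.
  apply: ae_foralln => n; exists [set w | xi w (ball 0%R n.+1%:R^-1) = 0].
  split.
  - by apply: measurable_xi_eq0; exact: measurable_ball_rV.
  - by apply: xi_ball_gt0; rewrite invr_gt0.
  - by move=> w /negP/negPn/eqP.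
apply: filterS h => w xiw U oU U0.
have /nbhs_ballP[e /= e0 eU] : nbhs (0 : Rd)%R U by exact: open_nbhs_nbhs.
(* Countably many radii [n.+1%:R^-1] keep the exceptional set null; this [n] gives one of them below
   [e]. *)
pose n := truncn e^-1.
have ne : (n.+1%:R^-1 <= e)%R.
  by rewrite invf_ple ?posrE// ltW// truncnS_gt.
apply: (@lt_le_trans _ _ (xi w (ball 0%R n.+1%:R^-1))).
  by rewrite lt0e xiw measure_ge0.
apply: le_measure; rewrite ?inE.
- exact: measurable_ball_rV.
- exact: open_measurable_rV.
- by apply: subset_trans eU; exact: le_ball.
Qed.

End window_mass.

(** * Mass-stationarity *)

Section mass_stationarity.
Context {R : realType} {d : nat}.
Local Notation Rd := 'rV[R]_d.
Local Notation lambda := (lebesgue_rV R d).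
Local Open Scope ereal_scope.
Context dG (G : measurableType dG) (th : Rd -> G -> G) (z0 : G -> R).
Hypothesis hth : shift_measurable th.
Hypothesis mz0 : measurable_fun setT z0.
Hypothesis z0_ge0 : forall g, (0 <= z0 g)%R.
Local Notation z := (field th z0).

Context dT (T : measurableType dT) (P : {measure set T -> \bar R}).
Context (W : T -> G) (xi : T -> lf_measure R d).
Hypothesis mW : measurable_fun setT W.
Hypothesis mxi : measurable_fun setT xi.
Hypothesis xiE : forall w B, measurable B ->
  xi w B = \int[lambda]_(s in B) (z s (W w))%:E.
Hypothesis sP : sigma_finite setT P.
Hypothesis statW : stationary P th W.
Variable Q : {measure set T -> \bar R}.
Hypothesis QE : forall A, measurable A -> Q A = \int[P]_(w in A) (z0 (W w))%:E.

Implicit Types (B : set Rd) (u v : Rd).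
Hypothesis sPW : sigma_finite setT (pushforward P (fun w => (W w, xi w))).

Local Notation Wxi := (fun w => (W w, xi w)).
Local Notation thxi := (pair_shift th (@lf_shift R d)).
Local Notation wfm := (with_field_measure hth mz0 z0_ge0).

Section window.
Variable C : set Rd.
Hypotheses (mC : measurable C) (bC : bounded_set C) (C0 : 0 < lambda C).

Let c : R := fine (lambda C).
Let X u g : R := fine (window_mass th z0 C u g).

Let lambdaCE : lambda C = c%:E.
Proof. by rewrite fineK// ge0_fin_numE// lebesgue_rV_bounded. Qed.

Let c0 : (0 < c)%R. Proof. by rewrite -lte_fin -lambdaCE. Qed.

Let XE u w : window_mass th z0 C u (W w) = (X u (W w))%:E.
Proof. by rewrite fineK//; exact: (window_mass_fin_num z0_ge0 xiE). Qed.

Let X_ge0 u g : (0 <= X u g)%R.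
Proof. by rewrite fine_ge0// window_mass_ge0. Qed.

Let mX dS (S : measurableType dS) (u : S -> Rd) (g : S -> G) :
  measurable_fun setT u -> measurable_fun setT g ->
  measurable_fun setT (fun y => X (u y) (g y)).
Proof.
move=> mu mg; apply: (measurableT_comp (fine_measurable measurableT)).
exact: measurable_window_mass.
Qed.

(** [k] is the joint density of the base point and [U]; [q y (u, v)] is the density at [v] of the
    law of [V] given [y] and [u]. As the inverse of [0] is [0], [q] vanishes identically when the
    window has no mass. *)
Let k (w : T) u : R := z0 (W w) * c^-1 * \1_C u.
Let q (y : G) (p : Rd * Rd) : R := \1_C (p.2 + p.1)%R * z p.2 y * (X p.1 y)^-1.

Let k_ge0 w u : (0 <= k w u)%R.
Proof. by rewrite !mulr_ge0// invr_ge0 ltW. Qed.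

Let q_ge0 y p : (0 <= q y p)%R.
Proof. by rewrite !mulr_ge0// ?invr_ge0//; exact: z0_ge0. Qed.

Let mk dS (S : measurableType dS) (w : S -> T) (u : S -> Rd) :
  measurable_fun setT w -> measurable_fun setT u ->
  measurable_fun setT (fun y => k (w y) (u y)).
Proof.
move=> mw mu; apply: measurable_funM; last exact: measurable_indic_comp.
apply: measurable_funM; last exact: measurable_cst.
exact: measurableT_comp mz0 (measurableT_comp mW mw).
Qed.

Let mq dS (S : measurableType dS) (y : S -> G) (p : S -> Rd * Rd) :
  measurable_fun setT y -> measurable_fun setT p ->
  measurable_fun setT (fun s => q (y s) (p s)).
Proof.
move=> my mp.
have mp1 : measurable_fun setT (fst \o p) by exact: measurableT_comp.
have mp2 : measurable_fun setT (snd \o p) by exact: measurableT_comp.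
apply: measurable_funM; last by apply: measurable_funV => //; exact: mX.
apply: measurable_funM; last exact: measurable_field.
apply: measurable_indic_comp => //; exact: measurable_funD_rV.
Qed.

Let kq (x : T * (Rd * Rd)) : R := k x.1 x.2.1 * q (W x.1) x.2.

Let kq_ge0 x : (0 <= kq x)%R. Proof. by rewrite mulr_ge0. Qed.

Let mkq : measurable_fun setT kq.
Proof.
apply: measurable_funM.
  by apply: mk => //; apply: measurableT_comp => //; exact: measurable_snd.
by apply: mq => //; exact: measurableT_comp.
Qed.

Let sigma_finite_lambda2 : sigma_finite setT (lambda \x lambda).
Proof. exact: product_sigma_finite (sigma_finiteT lambda). Qed.

(** Treating [(u, v)] as one parameter makes the shift by [V] a single use of
    [stationary_fubini]. *)
Let lambda2 : {sigma_finite_measure set (Rd * Rd)%type -> \bar R} :=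
  HB.pack_for (SigmaFiniteMeasure.type (Rd * Rd)%type R) (lambda \x lambda)
    (isSFinite.Build _ _ _ _ (sfinite_measure_sigma_finite sigma_finite_lambda2))
    (isSigmaFinite.Build _ _ _ _ sigma_finite_lambda2).

(* The joint law of the base point, U and V: U has density [\1_C / lambda C]
   and, given [(w, u)], V has density [z . (W w)] on [C - u], normalised *)
Let Q' : {measure set (T * (Rd * Rd))%type -> \bar R} :=
  @density_measure _ _ R (P \x lambda2) kq mkq kq_ge0.

Let integral_Q' (h : T * (Rd * Rd) -> \bar R) : measurable_fun setT h ->
  (forall x, 0 <= h x) ->
  \int[Q']_x h x = \int[P]_w \int[lambda2]_p (h (w, p) * (kq (w, p))%:E).
Proof.
move=> mh h0.
rewrite (@ge0_integral_density _ _ _ (P \x lambda2) Q' kq)//.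
rewrite (@sigma_finite_fubini_tonelli1 _ _ _ P _ _ lambda2
  (fun x => h x * (kq x)%:E) sP)//.
  by apply: emeasurable_funM => //; exact/measurable_EFinP.
by move=> x; rewrite mule_ge0// lee_fin.
Qed.

Let integral_Q'2 (h : T * (Rd * Rd) -> \bar R) : measurable_fun setT h ->
  (forall x, 0 <= h x) -> \int[Q']_x h x =
  \int[P]_w \int[lambda]_u \int[lambda]_v (h (w, (u, v)) * (kq (w, (u, v)))%:E).
Proof.
move=> mh h0; rewrite integral_Q'//; apply: eq_integral => w _.
rewrite (fubini_tonelli1 (fun p => h (w, p) * (kq (w, p))%:E))//.
  have mp : measurable_fun setT (pair w : Rd * Rd -> T * (Rd * Rd)).
    exact: measurable_pair1.
  apply: emeasurable_funM; first exact: measurableT_comp mh mp.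
  by apply/measurable_EFinP; exact: measurableT_comp mkq mp.
by move=> x; rewrite mule_ge0// lee_fin.
Qed.

Let integral_q w u :
  \int[lambda]_v (q (W w) (u, v))%:E = (X u (W w) * (X u (W w))^-1)%:E.
Proof.
under eq_integral do rewrite /q/= mulrC.
rewrite ge0_integralZl_real ?invr_ge0//; last 2 first.
- apply: measurable_funM; last exact: measurable_field1.
  apply: measurable_indic_comp => //.
  by apply: measurable_funD_rV => //; exact: measurable_cst.
- by move=> v; rewrite mulr_ge0//; exact: z0_ge0.
by rewrite -/(window_mass th z0 C u (W w)) XE -EFinM mulrC.
Qed.

(** Integrating out [v] leaves [X * X^-1], which is [1], or [0] for a window without mass. Keeping
    this factor makes the identity exact; [integral_normalised] removes it where a true
    normalisation is required. *)
Let integral_Q'1 (h : T * Rd -> R) : measurable_fun setT h ->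
  (forall x, 0 <= h x)%R ->
  \int[Q']_x (h (x.1, x.2.1))%:E = \int[P]_w \int[lambda]_u
    (h (w, u) * k w u * (X u (W w) * (X u (W w))^-1))%:E.
Proof.
move=> mh h0.
rewrite (@integral_Q'2 (fun x => (h (x.1, x.2.1))%:E)); first last.
- by move=> x; rewrite lee_fin.
- apply/measurable_EFinP; apply: (measurableT_comp mh).
  apply: measurable_fun_pair => //=.
  by apply: measurableT_comp => //; exact: measurable_snd.
apply: eq_integral => w _; apply: eq_integral => u _.
rewrite [RHS]EFinM -integral_q -ge0_integralZl_real//.
- by apply: eq_integral => v _; rewrite -EFinM /kq/= mulrA.
- by rewrite mulr_ge0.
- by apply: mq.
Qed.

Let null u w : R := \1_[set 0] (window_mass th z0 C u (W w)).

(** By the convention for the inverse of [0], [X * X^-1] is the indicator of positive window mass,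
    and [null] is the complementary one. *)
Let null_split u w :
  (1 = X u (W w) * (X u (W w))^-1 + null u w)%R.
Proof.
rewrite /null XE; have [->|X0] := eqVneq (X u (W w)) 0%R.
  by rewrite mul0r add0r indicE mem_set.
rewrite divff// indicE memNset ?addr0// => -[] /eqP; exact/negP.
Qed.

Let null_ge0 u w : (0 <= null u w)%R. Proof. by []. Qed.

Let mnull dS (S : measurableType dS) (u : S -> Rd) (w : S -> T) :
  measurable_fun setT u -> measurable_fun setT w ->
  measurable_fun setT (fun y => null (u y) (w y)).
Proof.
move=> mu mw; apply: measurable_indic_comp; first exact: emeasurable_set1.
by apply: measurable_window_mass => //; exact: measurableT_comp mW mw.
Qed.

(* [xi (C - u)] vanishes only on a null set of the law of [(w, u)]. *)
Let integral_normalised (h : T * Rd -> R) : measurable_fun setT h ->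
  (forall x, 0 <= h x <= 1)%R ->
  \int[P]_w \int[lambda]_u (h (w, u) * k w u * (X u (W w) * (X u (W w))^-1))%:E =
  \int[P]_w \int[lambda]_u (h (w, u) * k w u)%:E.
Proof.
move=> mh h01.
have h0 p : (0 <= h p)%R by case/andP : (h01 p).
pose f1 (p : T * Rd) := (h p * k p.1 p.2 *
  (X p.2 (W p.1) * (X p.2 (W p.1))^-1))%:E.
pose f2 (p : T * Rd) := (h p * k p.1 p.2 * null p.2 p.1)%:E.
pose f3 (p : T * Rd) :=
  (c^-1 * (z0 (W p.1) * \1_C p.2 * null p.2 p.1))%:E.
have f10 p : 0 <= f1 p.
  rewrite /f1 lee_fin mulr_ge0//; first exact: mulr_ge0.
  by rewrite mulr_ge0// invr_ge0.
have f20 p : 0 <= f2 p by rewrite /f2 lee_fin mulr_ge0// mulr_ge0.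
have f30 p : 0 <= f3 p.
  by rewrite /f3 lee_fin mulr_ge0 ?invr_ge0 ?(ltW c0)// !mulr_ge0.
have mWp : measurable_fun setT (fun p : T * Rd => W p.1).
  exact: measurableT_comp mW measurable_fst.
have mhk : measurable_fun setT (fun p : T * Rd => h p * k p.1 p.2)%R.
  by apply: measurable_funM => //; exact: mk.
have mf1 : measurable_fun setT f1.
  apply/measurable_EFinP; apply: measurable_funM => //; apply: measurable_funM.
    exact: mX.
  by apply: measurable_funV => //; exact: mX.
have mnull2 : measurable_fun setT (fun p : T * Rd => null p.2 p.1) by exact: mnull.
have mf2 : measurable_fun setT f2.
  by apply/measurable_EFinP; exact: measurable_funM.
have mf3 : measurable_fun setT f3.
  apply/measurable_EFinP; apply: measurable_funM => //.
  apply: measurable_funM => //; apply: measurable_funM.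
    exact: measurableT_comp mz0 mWp.
  exact: measurable_indic_comp.
have mf2w w : measurable_fun setT (fun u => f2 (w, u)).
  exact: measurableT_comp mf2 (measurable_pair1 w).
have int_f2 : \int[P]_w \int[lambda]_u f2 (w, u) = 0.
  apply/eqP; rewrite eq_le; apply/andP; split; last first.
    by apply: integral_ge0 => w _; apply: integral_ge0 => u _.
  (* The bound [h <= 1] is what compares [f2] with [f3], whose integral is [c^-1] times the one in
     [window_mass_null]. *)
  apply: (@le_trans _ _ (\int[P]_w \int[lambda]_u f3 (w, u))).
    apply: ge0_le_integral => //.
    - by move=> w _; apply: integral_ge0 => u _.
    - exact: (measurable_fun_fubini_tonelli_F _ mf2).
    - exact: (measurable_fun_fubini_tonelli_F _ mf3).
    move=> w _; apply: ge0_le_integral => //.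
    - exact: measurableT_comp mf3 (measurable_pair1 w).
    move=> u _; rewrite /f2 /f3 lee_fin /=.
    have -> : (c^-1 * (z0 (W w) * \1_C u * null u w) = 1 * k w u * null u w)%R.
      by rewrite /k; ring.
    by rewrite !ler_wpM2r//; case/andP : (h01 (w, u)).
  pose J w := \int[lambda]_u (z0 (W w) * \1_C u * null u w)%:E.
  rewrite (_ : \int[P]_w _ = (c^-1)%:E * \int[P]_w \int[lambda]_u
      (z0 (W w) * \1_C u * null u w)%:E).
    by rewrite (window_mass_null hth mz0 z0_ge0 mW sP statW mC) mule0.
  have mf4 : measurable_fun setT (fun p : T * Rd =>
      (z0 (W p.1) * \1_C p.2 * null p.2 p.1)%R).
    apply: measurable_funM => //; apply: measurable_funM.
      exact: measurableT_comp mz0 mWp.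
    exact: measurable_indic_comp.
  rewrite -/(\int[P]_w J w) -ge0_integralZl_EFin ?invr_ge0 ?(ltW c0)//; last 2 first.
  - by move=> w _; apply: integral_ge0 => u _; rewrite lee_fin !mulr_ge0.
  - apply: (measurable_fun_fubini_tonelli_F (fun p : T * Rd =>
      (z0 (W p.1) * \1_C p.2 * null p.2 p.1)%:E)) => [|p].
      exact/measurable_EFinP.
    by rewrite lee_fin !mulr_ge0.
  apply: eq_integral => w _; rewrite /f3 /J.
  rewrite ge0_integralZl_real ?invr_ge0 ?(ltW c0)//.
  - exact: measurableT_comp mf4 (measurable_pair1 w).
  - by move=> u; rewrite !mulr_ge0.
pose I (f : T * Rd -> \bar R) w := \int[lambda]_u f (w, u).
have ID : \int[P]_w (I f1 w + I f2 w) = \int[P]_w I f1 w + \int[P]_w I f2 w.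
  apply: ge0_integralD => //.
  - by move=> w _; apply: integral_ge0 => u _.
  - exact: (measurable_fun_fubini_tonelli_F _ mf1).
  - by move=> w _; apply: integral_ge0 => u _.
  - exact: (measurable_fun_fubini_tonelli_F _ mf2).
transitivity (\int[P]_w (I f1 w + I f2 w)); first by rewrite ID int_f2 adde0.
apply: eq_integral => w _; rewrite /I -ge0_integralD//; last first.
  exact: measurableT_comp mf1 (measurable_pair1 w).
apply: eq_integral => u _; rewrite /f1 /f2 -EFinD -mulrDr/=.
by rewrite -null_split mulr1.
Qed.

(** With [B] the whole space this gives the law of the base point, and for general [B] the uniform
    law of [U] independently of it. *)
Let Q'_rect (A : set T) B : measurable A -> measurable B ->
  Q' [set x | A x.1 /\ B x.2.1] = Q A * (lambda (B `&` C) * (c^-1)%:E).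
Proof.
move=> mA mB.
have mAB : measurable [set x : T * (Rd * Rd) | A x.1 /\ B x.2.1].
  rewrite (_ : [set _ | _] = A `*` (B `*` setT)).
    by apply: measurableX => //; exact: measurableX.
  by apply/seteqP; split => [[w [u v]] [/= ? ?]|[w [u v]] [/= ? []]].
rewrite -(integral_indicE Q' mAB).
pose h (p : T * Rd) : R := (\1_A p.1 * \1_B p.2)%R.
have mh : measurable_fun setT h.
  by apply: measurable_funM; exact: measurable_indic_comp.
transitivity (\int[Q']_x (h (x.1, x.2.1))%:E).
  apply: eq_integral => x _; rewrite /h/= !indicE -natrM mulnb.
  congr (_%:R%:E); congr nat_of_bool.
  by apply/idP/andP => [/set_mem[]|[/set_mem ? /set_mem ?]]; rewrite ?inE.
rewrite integral_Q'1//; last by move=> x; rewrite mulr_ge0.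
rewrite integral_normalised//; last first.
  by move=> x; rewrite mulr_ge0//= mulr_ile1.
rewrite QE// -ge0_integralZr//; last 3 first.
- by apply/measurable_EFinP/measurable_funTS; exact: measurableT_comp.
- by move=> w _; rewrite lee_fin; exact: z0_ge0.
- by rewrite mule_ge0// lee_fin invr_ge0 ltW.
rewrite [RHS]integral_mkcond.
apply: eq_integral => w _; rewrite epatch_indic muleA.
transitivity (\int[lambda]_u (z0 (W w) * \1_A w * c^-1 * \1_(B `&` C) u)%:E).
  by apply: eq_integral => u _; rewrite indicI /h /k/=; congr _%:E; ring.
rewrite ge0_integralZl_real//; last 2 first.
- by rewrite !mulr_ge0// invr_ge0 ltW.
- exact: measurable_indic (measurableI _ _ mB mC).
rewrite integral_indicE; last exact: measurableI.
by rewrite !EFinM -!muleA; congr (_ * _); rewrite muleC -muleA muleCA.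
Qed.

Let mWxi : measurable_fun setT Wxi. Proof. exact: measurable_fun_pair. Qed.

Let measurable_preimageT d1 d2 (T1 : measurableType d1) (T2 : measurableType d2)
  (f : T1 -> T2) A : measurable_fun setT f -> measurable A -> measurable (f @^-1` A).
Proof. by move=> mf mA; rewrite -[X in measurable X]setTI; exact: mf. Qed.

Let Q'_fst (A : set T) : measurable A -> Q' (fst @^-1` A) = Q A.
Proof.
move=> mA; rewrite (_ : fst @^-1` A = [set x | A x.1 /\ setT x.2.1]).
  rewrite Q'_rect// setTI lambdaCE -EFinM divff ?mule1// gt_eqF//.
by apply/seteqP; split => [x /= ?|x [/=]].
Qed.

Let cond_measure_lambda B : cond_measure lambda C B = lambda (B `&` C) * (c^-1)%:E.
Proof. by rewrite /cond_measure lambdaCE inver gt_eqF. Qed.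

Let cond_U : cond_distribution Q' (fun x => x.2.1) (fun x => Wxi x.1)
  (fun _ => cond_measure lambda C).
Proof.
move=> A B mA mB; rewrite integral_cst; last first.
  by apply: measurable_preimageT => //; exact: measurableT_comp mWxi measurable_fst.
rewrite -/(cond_measure lambda C B) cond_measure_lambda muleC.
have mWA : measurable (Wxi @^-1` A) by exact: measurable_preimageT.
transitivity (Q (Wxi @^-1` A) * (lambda (B `&` C) * (c^-1)%:E)).
  exact: Q'_rect.
by congr (_ * _); exact/esym/(Q'_fst mWA).
Qed.

(** The mass under [xi w] of the part of [B] in the window [C - u]: the numerator of the conditional
    law of [V]. *)
Let B_mass B u w : \bar R := \int[lambda]_v (\1_B v * \1_C (v + u)%R * z v (W w))%:E.
Let b B u w : R := fine (B_mass B u w).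

Let B_massE B u w : measurable B -> B_mass B u w = (b B u w)%:E.
Proof.
move=> mB; rewrite fineK// /B_mass -(xi_window xiE)// ge0_fin_numE//.
apply: (@le_lt_trans _ _ (xi w [set y - u | y in C]%R)).
  have mCu : measurable [set y - u | y in C]%R.
    by rewrite image_subE; exact: measurable_preimageD.
  by apply: le_measure; rewrite ?inE//; exact: measurableI.
by rewrite (xi_window_mass xiE)// XE ltry.
Qed.

Let b_ge0 B u w : (0 <= b B u w)%R.
Proof.
rewrite fine_ge0//; apply: integral_ge0 => v _.
by rewrite lee_fin !mulr_ge0//; exact: z0_ge0.
Qed.

Let mb B : measurable B -> measurable_fun setT (fun p : T * Rd => b B p.2 p.1).
Proof.
move=> mB; apply: (measurableT_comp (fine_measurable measurableT)).
have -> : (fun p : T * Rd => B_mass B p.2 p.1) = (fun p => \int[lambda]_v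
    (\1_((B `*` setT) `&` ((fun x : Rd * (T * Rd) => x.1 + x.2.2)%R @^-1` C)) (v, p)
      * z v (W p.1))%:E).
  apply/funext => p; apply: eq_integral => v _; congr (_ * _)%:E.
  rewrite indicI; congr (_ * _)%R; by rewrite !indicE in_setX in_setT andbT.
apply: measurable_field_integral => //.
  apply: measurableI; first exact: measurableX.
  apply: measurable_preimageT => //; apply: measurable_funD_rV => //.
  by apply: measurableT_comp => //; exact: measurable_snd.
exact: measurableT_comp mW measurable_fst.
Qed.

Let cond_measure_xi B u w : measurable B ->
  cond_measure (xi w) [set y - u | y in C]%R B = (b B u w * (X u (W w))^-1)%:E.
Proof.
move=> mB; rewrite /cond_measure (xi_window xiE)// -/(B_mass B u w) B_massE//.
rewrite (xi_window_mass xiE)// XE inver; case: eqP => [X0|//].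
(* At zero window mass the extended inverse and the real one follow different conventions; both
   products are zero because the numerator is. *)
have b0 : b B u w = 0%R.
  apply/eqP; rewrite eq_le b_ge0 andbT -lee_fin -X0 -XE -B_massE//.
  rewrite -(xi_window_mass xiE)// /B_mass -(xi_window xiE)//.
  have mCu : measurable [set y - u | y in C]%R.
    by rewrite image_subE; exact: measurable_preimageD.
  by apply: le_measure; rewrite ?inE//; exact: measurableI.
by rewrite b0 mul0e mul0r.
Qed.

Let cond_V : cond_distribution Q' (fun x => x.2.2) (fun x => (Wxi x.1, x.2.1))
  (fun y => cond_measure y.1.2 [set y0 - y.2 | y0 in C]%R).
Proof.
move=> A B mA mB.
pose A1 := [set p : T * Rd | A (Wxi p.1, p.2)].
have mA1 : measurable A1.
  apply: measurable_preimageT => //; apply: measurable_fun_pair => //.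
  exact: measurableT_comp mWxi measurable_fst.
pose h p : R := (b B p.2 p.1 * (X p.2 (W p.1))^-1 * \1_A1 p)%R.
have mU1 : measurable_fun setT (fun x : T * (Rd * Rd) => (x.1, x.2.1)).
  apply: measurable_fun_pair => //.
  by apply: measurableT_comp => //; exact: measurable_snd.
have mV1 : measurable_fun setT (fun x : T * (Rd * Rd) => x.2.2).
  by apply: measurableT_comp => //; exact: measurable_snd.
transitivity (\int[Q']_x (h (x.1, x.2.1))%:E); last first.
  rewrite [RHS]integral_mkcond; apply: eq_integral => x _.
  by rewrite epatch_indic cond_measure_xi// -EFinM.
rewrite integral_Q'1; last 2 first.
- apply: measurable_funM; last exact: measurable_indic.
  apply: measurable_funM; first exact: mb.
  apply: measurable_funV => //; apply: mX => //.
  exact: measurableT_comp mW measurable_fst.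
- by move=> p; rewrite /h !mulr_ge0// invr_ge0.
have mAB : measurable ((fun x : T * (Rd * Rd) => (x.1, x.2.1)) @^-1` A1 `&`
    (fun x : T * (Rd * Rd) => x.2.2) @^-1` B).
  by apply: measurableI; exact: measurable_preimageT.
rewrite -(integral_indicE Q' mAB) integral_Q'2; last 2 first.
- exact/measurable_EFinP/measurable_indic.
- by move=> x; rewrite lee_fin.
apply: eq_integral => w _; apply: eq_integral => u _.
transitivity (\int[lambda]_v ((\1_A1 (w, u) * k w u * (X u (W w))^-1) *
    (\1_B v * \1_C (v + u)%R * z v (W w)))%:E).
  apply: eq_integral => v _; rewrite -EFinM indicI /kq /q /=; congr _%:E.
  rewrite -[\1_(_ @^-1` A1) _]/(\1_A1 (w, u)) -[\1_(_ @^-1` B) _]/(\1_B v).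
  by ring.
rewrite ge0_integralZl_real//; last 3 first.
- by rewrite !mulr_ge0// ?invr_ge0// ltW.
- apply: measurable_funM; last exact: measurable_field1.
  apply: measurable_funM; first exact: measurable_indic.
  by apply: measurable_indic_comp => //; exact: measurable_funD_rV.
- by move=> v; rewrite !mulr_ge0//; exact: z0_ge0.
rewrite -/(B_mass B u w) B_massE// -EFinM /h/=; congr _%:E.
(* The right-hand side has the extra factor [X * X^-1] from integrating out [v]. It is absorbed by
   the normalising [X^-1], also at [X = 0], where that inverse is [0]. *)
have [->|X0] := eqVneq (X u (W w)) 0%R; first by rewrite invr0; ring.
by field.
Qed.

(* [kq] seen from the base point shifted by [V] *)
Let shifted (g : G * Rd -> R) (x : G * (Rd * Rd)) : R :=
  (g (x.1, x.2.2 + x.2.1) *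
   (z (- x.2.2) x.1 * c^-1 * \1_C x.2.1 * \1_C (x.2.2 + x.2.1) * z0 x.1 *
    (X (x.2.1 + x.2.2) x.1)^-1))%R.

Let shifted_ge0 g x : (forall p, 0 <= g p)%R -> (0 <= shifted g x)%R.
Proof.
move=> g0; rewrite /shifted mulr_ge0// !mulr_ge0// ?invr_ge0// ?(ltW c0)//.
exact: z0_ge0.
Qed.

Let measurable_shifted g : measurable_fun setT g -> measurable_fun setT (shifted g).
Proof.
move=> mg.
have m1 : measurable_fun setT (fun x : G * (Rd * Rd) => x.2.1).
  by apply: measurableT_comp => //; exact: measurable_snd.
have m2 : measurable_fun setT (fun x : G * (Rd * Rd) => x.2.2).
  by apply: measurableT_comp => //; exact: measurable_snd.
apply: measurable_funM.
  apply: (measurableT_comp mg); apply: measurable_fun_pair => //.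
  exact: measurable_funD_rV.
apply: measurable_funM; last first.
  by apply: measurable_funV => //; apply: mX => //; exact: measurable_funD_rV.
apply: measurable_funM; last exact: measurableT_comp mz0 measurable_fst.
apply: measurable_funM; last first.
  by apply: measurable_indic_comp => //; exact: measurable_funD_rV.
apply: measurable_funM; last exact: measurable_indic_comp.
apply: measurable_funM => //.
by apply: measurable_field => //; exact: measurable_funN_rV.
Qed.

(** The weight [a] collects what depends only on the new value of [U]; the rest integrates to the
    mass of the window at that value. Cancellation with the normaliser leaves [X * X^-1], the very
    factor in [integral_Q'1], so no exceptional set has to be discarded. *)
Let integral_shifted w (g : G * Rd -> R) : measurable_fun setT g ->
  (forall p, 0 <= g p)%R ->
  \int[lambda2]_p (shifted g (W w, p))%:E =
  \int[lambda]_u (g (W w, u) * k w u * (X u (W w) * (X u (W w))^-1))%:E.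
Proof.
move=> mg g0.
have mzw dS (S : measurableType dS) (u : S -> Rd) : measurable_fun setT u ->
    measurable_fun setT (fun s => z (u s) (W w)).
  by move=> mu; exact: measurable_field.
have mCw dS (S : measurableType dS) (u : S -> Rd) : measurable_fun setT u ->
    measurable_fun setT (fun s => \1_C (u s) : R).
  by move=> mu; exact: measurable_indic_comp.
pose f p := (shifted g (W w, p))%:E.
have f0 p : 0 <= f p by rewrite lee_fin shifted_ge0.
have mf : measurable_fun setT f.
  apply/measurable_EFinP.
  exact: measurableT_comp (measurable_shifted mg) (measurable_pair1 _).
transitivity (\int[lambda]_u \int[lambda]_v f (u, v)).
  by apply: (fubini_tonelli1 (m1 := lambda) (m2 := lambda) f).
pose a v : R := (g (W w, v) * k w v * (X v (W w))^-1)%R.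
have a0 v : (0 <= a v)%R by rewrite /a mulr_ge0 ?invr_ge0// mulr_ge0.
have ma : measurable_fun setT a.
  apply: measurable_funM; last by apply: measurable_funV => //; exact: mX.
  apply: measurable_funM; last exact: mk.
  exact: measurableT_comp mg (measurable_pair1 _).
pose f' (p : Rd * Rd) := (a p.2 * (\1_C p.1 * z (p.1 - p.2)%R (W w)))%:E.
have f'0 p : 0 <= f' p.
  by rewrite lee_fin mulr_ge0// mulr_ge0//; exact: z0_ge0.
have mf' : measurable_fun setT f'.
  apply/measurable_EFinP; apply: measurable_funM.
    exact: measurableT_comp.
  apply: measurable_funM; first exact: mCw.
  apply: mzw; apply: measurable_funD_rV => //; exact: measurable_funN_rV.
transitivity (\int[lambda]_u \int[lambda]_v f' (u, v)).
  apply: eq_integral => u _.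
  (* After this translation [v] stands for the new value of [U], the old sum [u + v]. *)
  rewrite -(ge0_integral_rV_translation (f := fun v => f (u, v)) (- u)%R)//.
    apply: eq_integral => v _; rewrite /f /f' /shifted /a /k/= subrK opprB.
    have -> : (u + (v - u) = v)%R by rewrite addrC subrK.
    by congr _%:E; ring.
  exact: measurableT_comp mf (measurable_pair1 u).
rewrite (fubini_tonelli f')//; apply: eq_integral => v _; rewrite /f'/=.
have mCz : measurable_fun setT (fun u => \1_C u * z (u - v)%R (W w))%R.
  apply: measurable_funM; first exact: mCw.
  apply: mzw; apply: measurable_funD_rV => //.
rewrite ge0_integralZl_real//; last first.
  by move=> u; rewrite mulr_ge0//; exact: z0_ge0.
(* Translating [u] by [v] brings the integrand into the form used in [window_mass]. *)
rewrite -(ge0_integral_rV_translation (f := fun u =>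
  (\1_C u * z (u - v)%R (W w))%:E) v)//; last 2 first.
- exact/measurable_EFinP.
- by move=> u; rewrite lee_fin mulr_ge0//; exact: z0_ge0.
under eq_integral do rewrite addrK.
rewrite -/(window_mass th z0 C v (W w)) XE -EFinM /a; congr _%:E; ring.
Qed.

Let shift_V : eq_law Q' (fun x => (thxi x.2.2 (Wxi x.1), x.2.2 + x.2.1)%R)
  (fun x => (Wxi x.1, x.2.1)).
Proof.
move=> A mA.
pose A1 := [set p : G * Rd | A (wfm p.1, p.2)].
have mA1 : measurable A1.
  apply: measurable_preimageT => //; apply: measurable_fun_pair => //.
  apply: measurableT_comp measurable_fst; exact: measurable_with_field_measure.
have mAu u : measurable [set y : G * lf_measure R d | A (y, u)].
  exact: (measurable_preimageT (measurable_pair2 u) mA).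
have mx21 : measurable_fun setT (fun x : T * (Rd * Rd) => x.2.1).
  by apply: measurableT_comp => //; exact: measurable_snd.
have mx22 : measurable_fun setT (fun x : T * (Rd * Rd) => x.2.2).
  by apply: measurableT_comp => //; exact: measurable_snd.
have mWx : measurable_fun setT (fun x : T * (Rd * Rd) => W x.1).
  exact: measurableT_comp mW measurable_fst.
pose f1 (x : T * (Rd * Rd)) := (th x.2.2 (W x.1), x.2.2 + x.2.1)%R.
pose f2 (x : T * (Rd * Rd)) := (W x.1, x.2.1).
have mf1 : measurable_fun setT f1.
  apply: measurable_fun_pair; first exact: measurable_shift.
  exact: measurable_funD_rV.
have mf2 : measurable_fun setT f2 by exact: measurable_fun_pair.
rewrite /pushforward.
transitivity (Q' (f1 @^-1` A1)).
  congr (Q' _); apply/funext => x.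
  exact: (field_measure_shift_setE hth mz0 z0_ge0 xiE x.2.2 x.1 (mAu _)).
transitivity (Q' (f2 @^-1` A1)); last first.
  congr (Q' _); apply/funext => x; apply/esym.
  exact: (field_measure_setE hth mz0 z0_ge0 xiE x.1 (mAu _)).
have mS1 : measurable (f1 @^-1` A1) by exact: measurable_preimageT.
have mS2 : measurable (f2 @^-1` A1) by exact: measurable_preimageT.
rewrite -(integral_indicE Q' mS1) -(integral_indicE Q' mS2).
(* Both laws are reduced to this integral, with the factor [X * X^-1] left in place on either
   side. *)
transitivity (\int[P]_w \int[lambda]_u (\1_A1 (W w, u) * k w u *
    (X u (W w) * (X u (W w))^-1))%:E); last first.
  rewrite -(integral_Q'1 (h := fun p => \1_A1 (W p.1, p.2)))//.
  apply: measurable_indic_comp => //; apply: measurable_fun_pair => //.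
  exact: measurableT_comp mW measurable_fst.
rewrite integral_Q'; last 2 first.
- exact/measurable_EFinP/measurable_indic.
- by move=> x; rewrite lee_fin.
pose F x := (shifted \1_A1 x)%:E.
transitivity (\int[P]_w \int[lambda2]_p F (th p.2 (W w), p)).
  apply: eq_integral => w _; apply: eq_integral => -[u v] _.
  rewrite -EFinM /F /shifted /kq /k /q /=; congr _%:E.
  rewrite -[\1_(_ @^-1` A1) _]/(\1_A1 (th v (W w), v + u)%R).
  (* Evaluated at [th v (W w)], the window of [u + v] is the window of [u] seen from [W w], and
     [z (- v)] returns the value of [z0] at [W w]. *)
  rewrite /X window_mass_shift// addrK field_shift// addNr.
  rewrite -[z v (W w)]/(z0 (th v (W w))) {1}/field.
  have -> : th 0%R (W w) = W w by case: hth.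
  by ring.
rewrite (stationary_fubini hth mW sP statW lambda2 (tau := snd) (F := F))//.
- by apply: eq_integral => w _; rewrite -(integral_shifted w (g := \1_A1)).
- by apply/measurable_EFinP; apply: measurable_shifted; exact: measurable_indic.
- by move=> p; rewrite lee_fin shifted_ge0.
Qed.

Lemma mass_stationary_window :
  exists (dT' : measure_display) (T' : measurableType dT')
    (Q' : {measure set T' -> \bar R}) (pi : {mfun T' >-> T})
    (U V : {mfun T' >-> Rd}),
  [/\ forall A, measurable A -> pushforward Q' pi A = Q A,
      cond_distribution Q' U (fun w => Wxi (pi w)) (fun _ => cond_measure lambda C),
      cond_distribution Q' V (fun w => (Wxi (pi w), U w))
        (fun y => cond_measure y.1.2 [set c - y.2 | c in C]%R) &
      eq_law Q' (fun w => (thxi (V w) (Wxi (pi w)), V w + U w)%R)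
                (fun w => (Wxi (pi w), U w))].
Proof.
have m1 : measurable_fun setT (fun x : T * (Rd * Rd) => x.2.1).
  by apply: measurableT_comp => //; exact: measurable_snd.
have m2 : measurable_fun setT (fun x : T * (Rd * Rd) => x.2.2).
  by apply: measurableT_comp => //; exact: measurable_snd.
pose pi : {mfun (T * (Rd * Rd))%type >-> T} :=
  HB.pack (fst : T * (Rd * Rd) -> T) (isMeasurableFun.Build _ _ _ _ _ measurable_fst).
pose U : {mfun (T * (Rd * Rd))%type >-> Rd} :=
  HB.pack (fun x : T * (Rd * Rd) => x.2.1) (isMeasurableFun.Build _ _ _ _ _ m1).
pose V : {mfun (T * (Rd * Rd))%type >-> Rd} :=
  HB.pack (fun x : T * (Rd * Rd) => x.2.2) (isMeasurableFun.Build _ _ _ _ _ m2).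
exists _, _, Q', pi, U, V; split.
- exact: Q'_fst.
- exact: cond_U.
- exact: cond_V.
- exact: shift_V.
Qed.

End window.

Lemma mass_stationary_field : mass_stationary th W xi Q.
Proof.
split.
- exact: (sigma_finite_law mz0 z0_ge0 mW mxi QE sPW).
- exact: (support_xi hth mz0 z0_ge0 mW xiE sP statW QE).
- by move=> C mC bC C0 _; exact: mass_stationary_window.
Qed.

End mass_stationarity.

(** * From the abstract shift space back to random fields *)

Theorem theorem4 (R : realType) (d : nat)
    (dT : measure_display) (T : measurableType dT)
    (P : {measure set T -> \bar R})
    (dE : measure_display) (E : measurableType dE) (thE : 'rV[R]_d -> E -> E)
    (X : {mfun T >-> E})
    (H : path_space R d) (Z : {mfun T >-> path_of H})
    (xi : {mfun T >-> lf_measure R d}) :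
  shift_measurable thE ->
  density_field xi Z ->
  sigma_finite setT (pushforward P (fun w => ((X w, Z w), xi w))) ->
  let thW := pair_shift thE (@path_shift R d H) in
  let W := fun w => (X w, Z w) in
  stationary P thW W ->
  mass_stationary thW W xi (Z0P P Z) /\ palm_version thW W xi (Z0P P Z) P.
Proof.
move=> [thE0 thED mthE] [[thZ0 thZD mthZ] xiE] sPW thW W statW.
have hth : shift_measurable thW.
  split.
  - by move=> [x y]; rewrite /thW /pair_shift/= thE0 thZ0.
  - by move=> s t [x y]; rewrite /thW /pair_shift/= thED thZD.
  - have mp1 : measurable_fun setT (fun p : 'rV[R]_d * (E * path_of H) => p.2.1).
      by apply: measurableT_comp => //; exact: measurable_snd.
    have mp2 : measurable_fun setT (fun p : 'rV[R]_d * (E * path_of H) => p.2.2).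
      by apply: measurableT_comp => //; exact: measurable_snd.
    apply: measurable_fun_pair.
    + exact: (measurableT_comp mthE (measurable_fun_pair measurable_fst mp1)).
    + exact: (measurableT_comp mthZ (measurable_fun_pair measurable_fst mp2)).
pose z0 (y : E * path_of H) : R := y.2 0.
have mz0 : measurable_fun setT z0.
  exact: measurableT_comp (measurable_path_eval 0) measurable_snd.
have z0_ge0 y : 0 <= z0 y by exact: (path_set_ge0 (path_funP y.2)).
have mW : measurable_fun setT W by exact: measurable_fun_pair.
have mxi : measurable_fun setT xi by exact: measurable_funP.
have xiE' w B : measurable B ->
    xi w B = (\int[lebesgue_rV R d]_(s in B) (field thW z0 s (W w))%:E)%E.
  move=> mB; rewrite xiE//; apply: eq_integral => s _.
  by rewrite /field /z0 /W /= addr0.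
(* Preimages under [(W, xi)] of an exhaustion for the law exhaust [T], with the same masses. *)
have sP : sigma_finite setT P.
  have [F FT Foo] := sPW.
  exists (fun n => (fun w => (W w, xi w)) @^-1` F n) => [|n].
    by rewrite -preimage_bigcup -FT preimage_setT.
  have [mF Fn] := Foo n; split=> //.
  rewrite -[X in measurable X]setTI.
  exact: (measurable_fun_pair mW mxi).
have QE A : measurable A ->
  Z0P P Z A = (\int[P]_(w in A) (z0 (W w))%:E)%E by [].
split.
- exact: (mass_stationary_field hth mz0 z0_ge0 mW mxi xiE' sP statW QE sPW).
- exact: (palm_version_field hth mz0 z0_ge0 mW mxi xiE' sP statW QE).
Qed.
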